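(* Let $g$ be a non-zero Maass cusp form for the full modular group $SL_2(\mathbb{Z})$ with Laplace eigenvalue $\frac14+\nu^2$ and Fourier expansion $$g(z)=\sum_{n\ne 0}a_n\sqrt{y}\,K_{i\nu}(2\pi|n|y)e^{2\pi inx},\qquad z=x+iy,$$ and suppose that $g$ is either even or odd. Assume that $a_n$ is a real number for every $n\ge 1$. Then the sequence $\{a_n\}_{n=1}^\infty$ changes signs infinitely often.
   Context: Here $K_{i\nu}$ is the modified Bessel function of the third kind. The form $g$ is even if $g(-\bar z)=g(z)$ and odd if $g(-\bar z)=-g(z)$. A sequence of real numbers changes signs infinitely often if it has infinitely many strictly positive terms and infinitely many strictly negative terms. *)

(* Defs.v *)
From HB Require Import structures.
From mathcomp Require Import all_boot all_order all_algebra.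
From mathcomp Require Import all_classical all_reals all_analysis.
From mathcomp Require Import complex.

Set Implicit Arguments.
Unset Strict Implicit.
Unset Printing Implicit Defensive.

Import Order.TTheory GRing.Theory Num.Theory.
Import numFieldNormedType.Exports.

Local Open Scope classical_set_scope.
Local Open Scope complex_scope.
Local Open Scope ring_scope.

Notation Re := complex.Re.
Notation Im := complex.Im.

Section ComplexFunctions.
Context {R : realType}.

Definition cexp (z : R[i]) : R[i] :=
  (expR (Re z))%:C * (cos (Im z) +i* sin (Im z)).

Definition ccosh (z : R[i]) : R[i] := (cexp z + cexp (- z)) / 2.

Definition cintegral (D : set R) (f : R -> R[i]) : R[i] :=
  (\int[lebesgue_measure]_(t in D) Re (f t)) +i*
  (\int[lebesgue_measure]_(t in D) Im (f t)).

(* K_s(x) = \int_0^oo exp(- x cosh t) cosh(s t) dt, for x > 0 and any complex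
   order s; the integral converges absolutely.  K is also called the modified
   Bessel function of the second kind, or Macdonald function. *)
Definition besselK (s : R[i]) (x : R) : R[i] :=
  cintegral `[0, +oo[%classic
    (fun t => cexp (- (x%:C * ccosh t%:C)) * ccosh (s * t%:C)).

(* The unordered sum of c over the nonzero integers is S: the family
   converges absolutely and its symmetric partial sums tend to S. *)
Definition nonzero_int_sum (c : int -> R[i]) (S : R[i]) : Prop :=
  let partial (N : nat) := \sum_(1 <= n < N.+1) (c n%:Z + c (- n%:Z)) in
  [/\ cvgn (fun N : nat => \sum_(1 <= n < N.+1)
        (Normc.normc (c n%:Z) + Normc.normc (c (- n%:Z)))),
      (fun N => Re (partial N)) @ \oo --> Re S &
      (fun N => Im (partial N)) @ \oo --> Im S].

End ComplexFunctions.

Section MaassForms.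
Context {R : realType}.

(* Functions on the upper half-plane are represented by total functions on
   R[i], of which only the values at points of positive imaginary part are
   ever constrained. *)
Definition upper (z : R[i]) : Prop := 0 < Im z.

Definition moebius (A : 'M[int]_2) (z : R[i]) : R[i] :=
  let i0 : 'I_2 := ord0 in let i1 : 'I_2 := ord_max in
  ((A i0 i0)%:~R * z + (A i0 i1)%:~R) / ((A i1 i0)%:~R * z + (A i1 i1)%:~R).

Definition partial_x (u : R -> R -> R) : R -> R -> R :=
  fun x y => derive1 (fun t => u t y) x.
Definition partial_y (u : R -> R -> R) : R -> R -> R :=
  fun x y => derive1 (fun t => u x t) y.

(* A word in {x, y} encodes a mixed partial derivative: true stands for x. *)
Definition iter_partial (w : seq bool) (u : R -> R -> R) : R -> R -> R :=
  foldr (fun b v => if b then partial_x v else partial_y v) u w.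

(* C^oo on the upper half-plane: all mixed partial derivatives, of all
   orders, exist there and are jointly continuous. *)
Definition smooth_upper (u : R -> R -> R) : Prop :=
  forall (w : seq bool) (x y : R), 0 < y ->
    let v := iter_partial w u in
    [/\ derivable (fun t => v t y) x 1,
        derivable (fun t => v x t) y 1 &
        {for (x, y), continuous (fun p : R * R => v p.1 p.2)}].

Definition re_part (g : R[i] -> R[i]) (x y : R) : R := Re (g (x +i* y)).
Definition im_part (g : R[i] -> R[i]) (x y : R) : R := Im (g (x +i* y)).

Definition hyp_laplacian (u : R -> R -> R) (x y : R) : R :=
  - (y ^+ 2 * (partial_x (partial_x u) x y + partial_y (partial_y u) x y)).

Definition laplacian (g : R[i] -> R[i]) (z : R[i]) : R[i] :=
  hyp_laplacian (re_part g) (Re z) (Im z) +i*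
  hyp_laplacian (im_part g) (Re z) (Im z).

(* The zero function is allowed, as an element of the space of cusp forms. *)
Record maass_cusp_form (lambda : R[i]) (g : R[i] -> R[i]) : Prop := {
  maass_smooth : smooth_upper (re_part g) /\ smooth_upper (im_part g) ;
  maass_invariant : forall A : 'M[int]_2, \det A = 1 ->
    forall z, upper z -> g (moebius A z) = g z ;
  maass_eigen : forall z, upper z -> laplacian g z = lambda * g z ;
  maass_growth : exists (C : R) (k : nat), forall z, 1 <= Im z ->
    Normc.normc (g z) <= C * Im z ^+ k ;
  maass_cuspidal : forall y : R, 0 < y ->
    cintegral `[0, 1]%classic (fun x => g (x +i* y)) = 0 }.

Definition nonzero_form (g : R[i] -> R[i]) : Prop :=
  exists2 z, upper z & g z != 0.

Definition even_form (g : R[i] -> R[i]) : Prop :=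
  forall z, upper z -> g (- z^*) = g z.
Definition odd_form (g : R[i] -> R[i]) : Prop :=
  forall z, upper z -> g (- z^*) = - g z.

(* a_n sqrt(y) K_{i nu}(2 pi |n| y) e^{2 pi i n x} at z = x + i y *)
Definition maass_fourier_term (nu : R[i]) (a : int -> R[i]) (z : R[i])
    (n : int) : R[i] :=
  a n * (Num.sqrt (Im z))%:C
  * besselK ('i%C * nu) (2 * pi * `|n|%:~R * Im z)
  * cexp (2 * pi%:C * 'i%C * n%:~R * (Re z)%:C).

(* The value a 0 plays no role. *)
Definition maass_fourier_expansion (nu : R[i]) (a : int -> R[i])
    (g : R[i] -> R[i]) : Prop :=
  forall z, upper z -> nonzero_int_sum (maass_fourier_term nu a z) (g z).

Definition changes_signs_infinitely_often (u : nat -> R) : Prop :=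
  infinite_set [set n | 0 < u n] /\ infinite_set [set n | u n < 0].

End MaassForms.

(* Main.v *)
Require Import Defs.
From mathcomp Require Import all_boot all_order all_algebra.
From mathcomp Require Import all_classical all_reals all_analysis.
From mathcomp Require Import measurable_realfun.
From mathcomp Require Import complex.
From mathcomp Require Import ring lra zify.

(** Write s for i nu, e(x) for exp (2 pi i x), and b_n(y) for
    a_n sqrt(y) K_s(2 pi |n| y), so that the sum of the b_n(y) e(n x) is
    g(x + i y).

    Suppose that the a_n with n large all have the same sign.  The form decays
    faster than any power of the height at infinity, hence, by invariance under
    z |-> -1/z, for every p it is O(((x^2 + y^2) / y)^p) on the whole upper
    half-plane ([form_decay]): it is very small close to the cusp 0.  For a
    large n take y of size 1/n and test g(. + i y) against the power 2p of a
    Dirichlet kernel of length about n, shifted so that its frequencies are of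
    size n.  The kernel is concentrated at |x| ~ 1/n, where g is small, so the
    pairing is small.  It is also a sum of the b_k(y) with nonnegative weights,
    over frequencies k for which 2 pi k y is so large that K_s has positive real
    part there; the real parts of the summands thus share one sign, and no
    cancellation is possible.  Hence a_n = O(n^(-p)) for every p
    ([coef_rapid_decay]).

    This decay is too strong.  It makes g(. + i y), up to a negligible error, a
    trigonometric polynomial of degree X ~ y^(-1/4), which is controlled by its
    values at the 2 X + 1 rational points j / (2 X + 1) ([form_le_nodes]).
    Above a rational of denominator q the point at height y is equivalent under
    the modular group to a point of height at least 1 / (q^2 y)
    ([modular_cusp]), so that these values are O(q^2 y) = O(1 / X^2).  Summing
    the O(X) coefficients shows that g tends to 0 as y tends to 0, uniformly in
    x.  Every orbit contains points of arbitrarily small height, so g vanishes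
    identically ([form_vanishes]). *)

Set Implicit Arguments.
Unset Strict Implicit.
Unset Printing Implicit Defensive.

Import Order.TTheory GRing.Theory Num.Theory.
Import numFieldNormedType.Exports.

Local Open Scope complex_scope.
Local Open Scope ring_scope.

Local Notation Re := complex.Re.
Local Notation Im := complex.Im.
Local Notation cabs := Normc.normc.

(** * Elementary estimates *)

Section RealBounds.
Context {R : realType}.

(** The k-th power of exp (x / k) >= x / k. *)
Lemma expR_ge_pow (k : nat) (x : R) : 0 <= x -> x ^+ k <= k%:R ^+ k * expR x.
Proof.
case: k => [|k] x0; first by rewrite !expr0 mul1r -expR0 ler_expR.
have k0 : (0 : R) < k.+1%:R by rewrite ltr0n.
have -> : expR x = expR (x / k.+1%:R) ^+ k.+1.
  by rewrite -expRM_natl mulrCA divff ?mulr1// gt_eqF.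
rewrite -exprMn lerXn2r ?nnegrE ?(mulr_ge0 (ltW k0)) ?expR_ge0//.
rewrite -ler_pdivrMl// mulrC (le_trans _ (expR_ge1Dx _))// lerDr//.
Qed.

(** The finitely many first values are absorbed in the constant. *)
Lemma eventually_bounded (F : nat -> R) (N : nat) (C : R) :
  (forall n, (N <= n)%N -> F n <= C) ->
  exists2 C' : R, 0 < C' & forall n, F n <= C'.
Proof.
move=> h; pose S := \sum_(i < N) `|F i|.
have S0 : 0 <= S by apply: sumr_ge0.
exists (1 + `|C| + S); first by have := normr_ge0 C; lra.
move=> n; have [nN|Nn] := leqP N n.
  by have := h n nN; have := ler_norm C; lra.
have : `|F n| <= S.
  by rewrite /S (bigD1 (Ordinal Nn))//= lerDl sumr_ge0.
have := ler_norm (F n); have := normr_ge0 C; lra.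
Qed.

(** Comparison with the telescoping sum of 1 / n - 1 / (n + 1). *)
Lemma sum_inv_sqr_tail (X Y : nat) : (0 < X)%N ->
  \sum_(X.+1 <= n < Y) (n%:R ^- 2 : R) <= X%:R^-1.
Proof.
move=> X0.
have inv_sqr_le (n : nat) : (0 < n)%N ->
    (n.+1%:R ^- 2 : R) <= n%:R^-1 - n.+1%:R^-1.
  move=> n0; have nR : (0 : R) < n%:R by rewrite ltr0n.
  have -> : n%:R^-1 - n.+1%:R^-1 = n.+1%:R ^- 2 + (n%:R * n.+1%:R ^+ 2)^-1 :> R.
    by rewrite -natr1; field; rewrite !gt_eqF//; lra.
  by rewrite lerDl invr_ge0 mulr_ge0// ?exprn_ge0// ler0n.
have telescope m : \sum_(X.+1 <= n < X.+1 + m) (n%:R ^- 2 : R) <=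
    X%:R^-1 - (X + m)%:R^-1.
  elim: m => [|m IH]; first by rewrite !addn0 big_geq// subrr.
  rewrite addnS big_nat_recr/= ?leq_addr// addSn.
  have := inv_sqr_le (X + m)%N; rewrite addn_gt0 X0 => /(_ isT).
  move: IH; rewrite addnS addSn => IH h.
  by rewrite (le_trans (lerD IH h))// addrA subrK.
have [XY|YX] := leqP X.+1 Y; last by rewrite big_geq ?invr_ge0// ltnW.
rewrite -(subnKC XY) (le_trans (telescope _))// gerBl invr_ge0//.
Qed.

Lemma sum_inv_sqr (Y : nat) : \sum_(1 <= n < Y) (n%:R ^- 2 : R) <= 2.
Proof.
have [Y1|Y1] := leqP Y 1; first by rewrite big_geq.
rewrite big_ltn// expr1n invr1.
have := sum_inv_sqr_tail Y (ltn0Sn 0); rewrite invr1.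
lra.
Qed.

Lemma expRN_le_inv_sqr (n : nat) : (0 < n)%N ->
  expR (- (n%:R / 4)) <= (64 : R) * n%:R ^- 2.
Proof.
move=> n0; have nR : (0 : R) < n%:R by rewrite ltr0n.
have h4 : 0 <= n%:R / 4 :> R by rewrite divr_ge0// ltW.
have := expR_ge_pow 2 h4.
rewrite expRN ler_pdivlMr ?exprn_gt0// ler_pdivrMl ?expR_gt0//; lra.
Qed.

End RealBounds.

(** * Complex modulus and the circle *)

Section ComplexModulus.
Context {R : realType}.
Implicit Types z w : R[i].

Lemma cabsD z w : cabs (z + w) <= cabs z + cabs w.
Proof. exact: (@le_normcD R z w). Qed.

Lemma cabsN z : cabs (- z) = cabs z.
Proof. exact: (@normcN R z). Qed.

Lemma cabsB z w : cabs (z - w) <= cabs z + cabs w.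
Proof. by rewrite -(cabsN w) cabsD. Qed.

Lemma cabsM z w : cabs (z * w) = cabs z * cabs w.
Proof. exact: Normc.normcM. Qed.

Lemma cabs0 : cabs (0 : R[i]) = 0.
Proof. exact: Normc.normc0. Qed.

Lemma cabs1 : cabs (1 : R[i]) = 1.
Proof. exact: Normc.normc1. Qed.

Lemma cabs_ge0 z : 0 <= cabs z.
Proof. by case: z => a b; exact: sqrtr_ge0. Qed.

Lemma cabs_real (x : R) : cabs (x%:C) = `|x|.
Proof. by rewrite /= expr0n addr0 sqrtr_sqr. Qed.

Lemma cabs_nat (n : nat) : cabs (n%:R : R[i]) = n%:R.
Proof.
by rewrite -(rmorph_nat (real_complex R)) cabs_real ger0_norm.
Qed.

Lemma cabsX z n : cabs (z ^+ n) = cabs z ^+ n.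
Proof. by elim: n => [|n IH]; rewrite ?expr0 ?cabs1// !exprS cabsM IH. Qed.

Lemma Re_le_cabs z : `|Re z| <= cabs z.
Proof.
case: z => a b /=; rewrite -sqrtr_sqr ler_sqrt ?addr_ge0 ?sqr_ge0//.
by rewrite lerDl sqr_ge0.
Qed.

Lemma cabs_le_ReIm z : cabs z <= `|Re z| + `|Im z|.
Proof.
case: z => a b /=; rewrite -[leRHS]ger0_norm ?addr_ge0// -sqrtr_sqr.
rewrite ler_sqrt ?sqr_ge0// sqrrD !real_normK ?num_real//.
by rewrite lerD2r lerDl mulrn_wge0// mulr_ge0.
Qed.

Lemma cabs_sum (I : Type) (r : seq I) (P : pred I) (F : I -> R[i]) :
  cabs (\sum_(i <- r | P i) F i) <= \sum_(i <- r | P i) cabs (F i).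
Proof.
elim/big_ind2 : _ => [|z x w y hz hw|//]; first by rewrite cabs0.
exact: le_trans (cabsD _ _) (lerD hz hw).
Qed.

Lemma Re_sum (I : Type) (r : seq I) (P : pred I) (F : I -> R[i]) :
  Re (\sum_(i <- r | P i) F i) = \sum_(i <- r | P i) Re (F i).
Proof. exact: (raddf_sum (@complex.Re R : Rcomplex R -> R)). Qed.

Lemma Re_scale (x : R) z : Re (x%:C * z) = x * Re z.
Proof. by case: z => a b /=; rewrite mul0r subr0. Qed.

End ComplexModulus.

Section Circle.
Context {R : realType}.
Implicit Types x y : R.

(** The additive character e(x) = exp (2 pi i x). *)
Definition circ x : R[i] := cos (2 * pi * x) +i* sin (2 * pi * x).

Lemma circD x y : circ (x + y) = circ x * circ y.
Proof. by rewrite /circ mulrDr cosD sinD; simpc; congr (_ +i* _); ring. Qed.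

Lemma circ0 : circ 0 = 1.
Proof. by rewrite /circ mulr0 cos0 sin0. Qed.

Lemma circMn (n : nat) x : circ (n%:R * x) = circ x ^+ n.
Proof.
elim: n => [|n IH]; first by rewrite mul0r circ0.
by rewrite -natr1 mulrDl mul1r circD IH exprSr.
Qed.

Lemma circ1 : circ 1 = 1.
Proof. by rewrite /circ mulr1 mulr_natl cos2pi sin2pi. Qed.

Lemma circNK x : circ (- x) * circ x = 1.
Proof. by rewrite -circD addNr circ0. Qed.

Lemma circ_nat (n : nat) : circ n%:R = 1.
Proof. by rewrite -[n%:R]mulr1 circMn circ1 expr1n. Qed.

Lemma circN_nat (n : nat) : circ (- n%:R) = 1.
Proof. by have := circNK n%:R; rewrite circ_nat mulr1. Qed.

Lemma circ_int (k : int) : circ k%:~R = 1.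
Proof.
case: k => n; first exact: circ_nat.
by rewrite NegzE mulrNz; exact: circN_nat.
Qed.

Lemma cabs_circ x : cabs (circ x) = 1.
Proof. by rewrite /circ /= cos2Dsin2 sqrtr1. Qed.

(** On [0, 1] this is the mean value theorem; beyond, sine is increasing up to
    pi / 2. *)
Lemma sin_lower (t : R) : 0 <= t -> 2 * t <= pi -> cos 1 / 2 * t <= sin t.
Proof.
move=> t0 tpi; have c1 := cos1_gt0 R.
have pi2 := pi_ge2 R; have pi4 := @pihalf_lt2 R.
have t2 : t <= 2 by lra.
have small (y : R) : 0 <= y -> y <= 1 -> cos 1 * y <= sin y.
  move=> y0 y1.
  have [z] := @MVT_segment R sin cos 0 y y0 (fun x _ => is_derive_sin x)
     (continuous_subspaceT (@continuous_sin R)).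
  rewrite in_itv/= => /andP[z0 zy]; rewrite sin0 !subr0 => ->.
  rewrite ler_wpM2r//.
  have := le_trans zy y1; rewrite le_eqVlt => /predU1P[->//|z1].
  by apply/ltW; rewrite ltr_cos ?in_itv//=; lra.
have [t1|t1] := leP t 1; first by have := small _ t0 t1; nra.
have s1 := small _ ler01 (lexx 1).
have : sin 1 <= sin t by apply/ltW; rewrite ltr_sin ?in_itv//=; lra.
nra.
Qed.

(** Half-angle form of 1 - e(x) = -2 i sin (pi x) e(x / 2). *)
Lemma circ_chord x : cabs (1 - circ x) = 2 * `|sin (pi * x)|.
Proof.
have -> : 1 - circ x = (2 * sin (pi * x))%:C * (sin (pi * x) -i* cos (pi * x)).
  rewrite /circ (_ : 2 * pi * x = pi * x + pi * x); last by ring.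
  rewrite cosD sinD; simpc; congr (_ +i* _); last by ring.
  by have := cos2Dsin2 (pi * x); nra.
rewrite cabsM cabs_real normrM [`|2|]ger0_norm//=.
by rewrite sqrrN addrC cos2Dsin2 sqrtr1 mulr1.
Qed.

Lemma circ_chord_lower x : `|x| <= 1 / 2 -> cos 1 * `|x| <= cabs (1 - circ x).
Proof.
move=> x12; rewrite circ_chord.
have c1 := cos1_gt0 R; have pi2 := pi_ge2 R; have pi4 := @pihalf_lt2 R.
have -> : `|sin (pi * x)| = `|sin (pi * `|x|)|.
  by case: (ger0P x) => // _; rewrite mulrN sinN normrN.
have x0 := normr_ge0 x.
have pi0 : 0 <= pi :> R by exact: pi_ge0.
have px : 0 <= pi * `|x| by rewrite mulr_ge0.
have px2 : pi * `|x| <= pi * (1 / 2) by rewrite ler_wpM2l.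
have h : cos 1 / 2 * (pi * `|x|) <= sin (pi * `|x|) by apply: sin_lower; lra.
have : cos 1 * (2 * `|x|) <= cos 1 * (pi * `|x|).
  by rewrite ler_wpM2l ?(ltW c1)// ler_wpM2r.
have := ler_norm (sin (pi * `|x|)); have := mulr_ge0 (ltW c1) x0; lra.
Qed.

Lemma circ_neq1 x : 0 < `|x| -> `|x| < 1 -> circ x != 1.
Proof.
have c1 := cos1_gt0 R.
have half (y : R) : 0 < `|y| -> `|y| <= 1 / 2 -> circ y != 1.
  move=> y0 /circ_chord_lower h; apply/eqP => E; move: h.
  by rewrite E subrr cabs0 leNgt mulr_gt0.
move=> x0 x1; have [h|h] := leP `|x| (1 / 2); first exact: half.
have [xp|xn] := ltP 0 x.
  rewrite (_ : circ x = circ (x - 1)).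
    rewrite gtr0_norm// in x1 h; apply: half; first by rewrite normr_gt0; lra.
    by rewrite ler0_norm; lra.
  by rewrite circD (circN_nat 1) mulr1.
rewrite (_ : circ x = circ (x + 1)).
  rewrite ler0_norm// in x1 h; apply: half; first by rewrite normr_gt0; lra.
  by rewrite ger0_norm; lra.
by rewrite circD circ1 mulr1.
Qed.

(** Orthogonality of characters modulo Q: a geometric sum of ratio e(k / Q),
    which is a Q-th root of unity distinct from 1 unless k = 0. *)
Lemma circ_sum (Q : nat) (k : int) : (`|k| < Q)%N ->
  \sum_(j < Q) circ (k%:~R * (j%:R / Q%:R)) = if k == 0 then Q%:R else 0.
Proof.
move=> kQ; have Q0 : (0 < Q)%N by rewrite (leq_ltn_trans _ kQ).
have QR : (0 : R) < Q%:R by rewrite ltr0n.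
have [->|k0] := eqVneq k 0.
  under eq_bigr do rewrite mul0r circ0.
  by rewrite sumr_const card_ord.
pose w := circ (k%:~R / Q%:R).
under eq_bigr => j _ do rewrite mulrCA circMn -/w.
have wQ : w ^+ Q = 1.
  by rewrite /w -circMn mulrC divfK ?gt_eqF// circ_int.
have w1 : w != 1.
  have e : `|k%:~R / Q%:R : R| = `|k|%N%:R / Q%:R.
    by rewrite normrM normfV -intr_norm -abszE [`|Q%:R|]ger0_norm.
  apply: circ_neq1; rewrite e.
    by rewrite divr_gt0// ltr0n absz_gt0.
  by rewrite ltr_pdivrMr// mul1r ltr_nat.
apply/eqP; move: (subrX1 w Q); rewrite wQ subrr => /esym/eqP.
by rewrite mulf_eq0 subr_eq0 (negbTE w1).
Qed.

End Circle.

(** * Recovering Fourier coefficients *)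

Section NonzeroIntSum.
Context {R : realType}.
Implicit Types (c : int -> R[i]) (S : R[i]).

Definition pair_abs c (n : nat) : R := cabs (c n%:Z) + cabs (c (- n%:Z)).

Definition pair_sum c (X : nat) : R[i] :=
  \sum_(1 <= n < X.+1) (c n%:Z + c (- n%:Z)).

(** A bound on all finite pieces of the tail; it is unchanged when the terms are
    multiplied by characters ([tail_le_fourier]), hence uniform in x. *)
Definition tail_le c (X : nat) (d : R) :=
  forall Y, \sum_(X.+1 <= n < Y) pair_abs c n <= d.

Lemma pair_abs_ge0 c n : 0 <= pair_abs c n.
Proof. by rewrite addr_ge0// cabs_ge0. Qed.

Lemma pair_sum_sub c X Y d : tail_le c X d -> (X <= Y)%N ->
  cabs (pair_sum c Y - pair_sum c X) <= d.
Proof.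
move=> hd XY; rewrite /pair_sum (@big_cat_nat _ _ _ X.+1)//= addrAC subrr add0r.
apply: le_trans (hd Y.+1); rewrite (le_trans (cabs_sum _ _ _))//.
by apply: ler_sum => n _; exact: cabsD.
Qed.

Lemma nonzero_int_sum_tail c S X d : nonzero_int_sum c S -> tail_le c X d ->
  cabs (S - pair_sum c X) <= d.
Proof.
move=> [_ hRe hIm] hd; apply/ler_addgt0Pr => e e0.
have e20 : 0 < e / 2 by rewrite divr_gt0.
move/cvgrPdist_le : hRe => /(_ _ e20) [N1 _ h1].
move/cvgrPdist_le : hIm => /(_ _ e20) [N2 _ h2].
pose N := maxn X (maxn N1 N2).
have := h1 N; rewrite /= !leq_max leqnn orbT => /(_ isT) a1.
have := h2 N; rewrite /= !leq_max leqnn !orbT => /(_ isT) a2.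
have -> : S - pair_sum c X = (S - pair_sum c N) + (pair_sum c N - pair_sum c X).
  by rewrite addrA subrK.
rewrite (le_trans (cabsD _ _))// [leRHS]addrC lerD//; last first.
  by apply: pair_sum_sub => //; rewrite leq_maxl.
have ReB (z w : R[i]) : Re (z - w) = Re z - Re w by case: z w => ? ? [].
have ImB (z w : R[i]) : Im (z - w) = Im z - Im w by case: z w => ? ? [].
rewrite (le_trans (cabs_le_ReIm _))// ReB ImB [leRHS]splitr lerD//.
Qed.

Lemma nonzero_int_sum_tail_small c S e : nonzero_int_sum c S -> 0 < e ->
  exists X0, forall X, (X0 <= X)%N -> tail_le c X e.
Proof.
move=> [cv _ _] e0.
pose A N := \sum_(1 <= n < N.+1) pair_abs c n.
have ndA : {homo A : n m / (n <= m)%N >-> n <= m}.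
  move=> n m nm; rewrite /A [leRHS](@big_cat_nat _ _ _ n.+1)//= lerDl.
  by apply: sumr_ge0 => k _; exact: pair_abs_ge0.
have Ale := nondecreasing_cvgn_le ndA cv.
move/cvgrPdist_le : (cv) => /(_ _ e0) [X0 _ hX0].
exists X0 => X XX0 Y; have [XY|YX] := leqP X.+1 Y; last first.
  by rewrite big_geq ?(ltW e0)// ltnW.
have hX := hX0 X XX0; have hY := Ale Y.-1.
have E : A Y.-1 = A X + \sum_(X.+1 <= n < Y) pair_abs c n.
  by rewrite /A (ltn_predK XY) [LHS](@big_cat_nat _ _ _ X.+1).
move: hX; rewrite ger0_norm ?subr_ge0; last exact: Ale.
have := Ale X; move: hY; rewrite E -/(A X) /=; lra.
Qed.

Lemma nonzero_int_sum_le c S X d d' : nonzero_int_sum c S ->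
  \sum_(1 <= n < X.+1) pair_abs c n <= d -> tail_le c X d' ->
  cabs S <= d + d'.
Proof.
move=> hS hd hd'; rewrite -[S](subrK (pair_sum c X)) (le_trans (cabsD _ _))//.
rewrite addrC lerD ?(nonzero_int_sum_tail hS)//.
rewrite (le_trans (cabs_sum _ _ _))// (le_trans _ hd)//.
by apply: ler_sum => n _; exact: cabsD.
Qed.

End NonzeroIntSum.

Section FourierCoefficients.
Context {R : realType}.
Implicit Types (c : int -> R[i]) (f : R -> R[i]).

Definition fourier_term c (x : R) (n : int) : R[i] := c n * circ (n%:~R * x).

Definition fourier_series c f :=
  forall x, nonzero_int_sum (fourier_term c x) (f x).

Lemma pair_abs_fourier c x n : pair_abs (fourier_term c x) n = pair_abs c n.
Proof. by rewrite /pair_abs /fourier_term !cabsM !cabs_circ !mulr1. Qed.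

Lemma tail_le_fourier c x X d :
  tail_le (fourier_term c x) X d <-> tail_le c X d.
Proof.
have E Y : \sum_(X.+1 <= n < Y) pair_abs (fourier_term c x) n =
    \sum_(X.+1 <= n < Y) pair_abs c n.
  by apply: eq_bigr => n _; exact: pair_abs_fourier.
by split=> h Y; have := h Y; rewrite E.
Qed.

Definition fourier_approx c f (X : nat) (d : R) :=
  forall x, cabs (f x - pair_sum (fourier_term c x) X) <= d.

(** Uniform convergence of the symmetric partial sums.  It is stable under
    linear combinations of the coefficients, unlike [tail_le] with a given
    bound. *)
Definition uniform_fourier c f := forall e : R, 0 < e ->
  exists X0, forall X, (X0 <= X)%N -> fourier_approx c f X e.

Lemma fourier_series_approx c f X d :
  fourier_series c f -> tail_le c X d -> fourier_approx c f X d.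
Proof.
by move=> hf hd x; apply: nonzero_int_sum_tail (hf x) _; apply/tail_le_fourier.
Qed.

Lemma fourier_series_tail_small c f e : fourier_series c f -> 0 < e ->
  exists X0, forall X, (X0 <= X)%N -> tail_le c X e.
Proof.
move=> hf /(nonzero_int_sum_tail_small (hf 0)) [X0 h]; exists X0 => X XX.
exact: (tail_le_fourier c 0 X e).1 (h X XX).
Qed.

Lemma fourier_series_uniform c f : fourier_series c f -> uniform_fourier c f.
Proof.
move=> hf e /(fourier_series_tail_small hf) [X0 h]; exists X0 => X XX.
exact: fourier_series_approx (h X XX).
Qed.

(** The frequencies m in [-X, X] stay distinct modulo Q > 2 X, so averaging
    over the Q-th rational points isolates the coefficient at k. *)
Lemma coefficient_average c (k : int) (X Q : nat) :
  (0 < `|k| <= X)%N -> (2 * X < Q)%N ->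
  \sum_(j < Q) pair_sum (fourier_term c (j%:R / Q%:R)) X *
    circ (- k%:~R * (j%:R / Q%:R)) = Q%:R * c k.
Proof.
move=> /andP[k0 kX] XQ.
pose D (m : int) : R[i] := if m == k then Q%:R * c m else 0.
have avg (m : int) : (`|m| <= X)%N ->
    \sum_(j < Q) c m * circ (m%:~R * (j%:R / Q%:R)) *
      circ (- k%:~R * (j%:R / Q%:R)) = D m.
  move=> mX.
  under eq_bigr => j _ do rewrite -mulrA -circD -mulrDl -intrN -intrD.
  rewrite -mulr_sumr circ_sum; last by lia.
  by rewrite subr_eq0 /D; case: ifP => _; rewrite ?mulr0// mulrC.
under eq_bigr => j _ do rewrite /pair_sum mulr_suml.
rewrite exchange_big /=.
transitivity (\sum_(1 <= n < X.+1) (D n%:Z + D (- n%:Z))).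
  apply: eq_big_nat => n /andP[n1 nX].
  under eq_bigr => j _ do rewrite mulrDl.
  by rewrite big_split/= /fourier_term !avg//; lia.
have kin : `|k|%N \in index_iota 1 X.+1 by rewrite mem_index_iota k0.
rewrite (bigD1_seq `|k|%N) ?iota_uniq//=.
rewrite big1_seq ?addr0; last first.
  move=> n /andP[nk _]; rewrite /D.
  by do 2 (case: eqP => ?; first lia); rewrite addr0.
rewrite /D; case: (intP k) k0 {kX avg D} => [|n|n] // _.
  by rewrite absz_nat eqxx; case: eqP => [?|_]; [lia|rewrite addr0].
by rewrite abszN absz_nat eqxx; case: eqP => [?|_]; [lia|rewrite add0r].
Qed.

(** Pairing f with a trigonometric polynomial by a discrete average instead of
    an integral: only the values of f at the points j / Q matter, up to the
    truncation error d.  Letting X grow gives [fourier_extract], which pairs a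
    form with a kernel; a fixed X gives control of coefficients by finitely
    many values, as in [form_le_nodes]. *)
Lemma fourier_extract_nodes c f (D X Q : nat) (tau : nat -> R)
    (kap : nat -> int) (M d : R) :
  fourier_approx c f X d ->
  (forall k, (k < D)%N -> (0 < `|kap k| <= X)%N) -> (2 * X < Q)%N ->
  (forall k, 0 <= tau k) ->
  (forall j, (j < Q)%N -> cabs (f (j%:R / Q%:R) *
     \sum_(k < D) (tau k)%:C * circ (- (kap k)%:~R * (j%:R / Q%:R))) <= M) ->
  cabs (\sum_(k < D) (tau k)%:C * c (kap k)) <= M + d * \sum_(k < D) tau k.
Proof.
move=> hf hk XQ tau0 hM.
have Q0 : (0 : R) < Q%:R by rewrite ltr0n (leq_ltn_trans _ XQ).
pose T (x : R) : R[i] := \sum_(k < D) (tau k)%:C * circ (- (kap k)%:~R * x).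
have Tle x : cabs (T x) <= \sum_(k < D) tau k.
  rewrite (le_trans (cabs_sum _ _ _))//; apply: ler_sum => k _.
  by rewrite cabsM cabs_real cabs_circ mulr1 ger0_norm.
have avg : \sum_(j < Q)
      pair_sum (fourier_term c (j%:R / Q%:R)) X * T (j%:R / Q%:R) =
    Q%:R * \sum_(k < D) (tau k)%:C * c (kap k).
  under eq_bigr => j _ do rewrite mulr_sumr.
  rewrite exchange_big mulr_sumr /=; apply: eq_bigr => k _.
  under eq_bigr => j _ do rewrite mulrCA.
  by rewrite -mulr_sumr coefficient_average// ?hk// mulrCA.
rewrite -(ler_pM2l Q0).
have -> : Q%:R * cabs (\sum_(k < D) (tau k)%:C * c (kap k)) =
    cabs (Q%:R * \sum_(k < D) (tau k)%:C * c (kap k)).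
  by rewrite cabsM cabs_nat.
rewrite -avg (le_trans (cabs_sum _ _ _))//.
have -> : Q%:R * (M + d * \sum_(k < D) tau k) =
    \sum_(j < Q) (M + d * \sum_(k < D) tau k).
  by rewrite sumr_const card_ord mulr_natl.
apply: ler_sum => j _; set x := j%:R / Q%:R.
have -> : pair_sum (fourier_term c x) X * T x =
    f x * T x - (f x - pair_sum (fourier_term c x) X) * T x by ring.
by rewrite (le_trans (cabsB _ _))// lerD ?hM// cabsM ler_pM ?cabs_ge0.
Qed.

Lemma fourier_extract c f (D : nat) (tau : nat -> R) (kap : nat -> int)
    (M : R) :
  uniform_fourier c f ->
  (forall k, (k < D)%N -> (0 < `|kap k|)%N) -> (forall k, 0 <= tau k) ->
  (forall x,
    cabs (f x * \sum_(k < D) (tau k)%:C * circ (- (kap k)%:~R * x)) <= M) ->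
  cabs (\sum_(k < D) (tau k)%:C * c (kap k)) <= M.
Proof.
move=> hf hk tau0 hM; apply/ler_addgt0Pr => e e0.
set s := \sum_(k < D) tau k.
have s0 : 0 <= s by apply: sumr_ge0.
have e1 : 0 < e / (s + 1) by rewrite divr_gt0// ltr_wpDl.
have [X0 hX0] := hf _ e1.
pose X := (X0 + \sum_(k < D) `|kap k|)%N.
have H := @fourier_extract_nodes c f D X (2 * X).+1 tau kap M _
  (hX0 X (leq_addr _ _)).
apply: le_trans (H _ _ tau0 (fun j _ => hM _)) _ => //.
  by move=> k kD; rewrite hk//= /X (bigD1 (Ordinal kD))//=; lia.
rewrite lerD2l -/s mulrAC ler_pdivrMr ?ltr_wpDl//.
by rewrite ler_wpM2l ?(ltW e0)// lerDl.
Qed.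

Lemma fourier_coefficient_le c f (k : int) (M : R) : uniform_fourier c f ->
  (0 < `|k|)%N -> (forall x, cabs (f x) <= M) -> cabs (c k) <= M.
Proof.
move=> hf k0 hM.
have := @fourier_extract c f 1 (fun=> 1) (fun=> k) M hf (fun _ _ => k0)
  (fun=> ler01).
rewrite !big_ord_recl !big_ord0 addr0 mul1r; apply => x.
by rewrite big_ord_recl big_ord0 addr0 mul1r cabsM cabs_circ mulr1.
Qed.

(** The numbers c (- n) - eps * c n are the Fourier coefficients of the zero
    function. *)
Lemma parity_coefficients c f (eps : R[i]) (k : int) : uniform_fourier c f ->
  (0 < `|k|)%N -> (forall x, f (- x) = eps * f x) -> c (- k) = eps * c k.
Proof.
move=> hf k0 hpar.
pose c' (n : int) := c (- n) - eps * c n.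
have hc' : uniform_fourier c' (fun=> 0).
  move=> e e0; have e1 : 0 < e / (1 + cabs eps).
    by rewrite divr_gt0// ltr_pwDl// cabs_ge0.
  have [X0 h] := hf _ e1; exists X0 => X XX x; rewrite sub0r cabsN.
  have -> : pair_sum (fourier_term c' x) X =
      eps * (f x - pair_sum (fourier_term c x) X) -
      (f (- x) - pair_sum (fourier_term c (- x)) X).
    have -> : pair_sum (fourier_term c' x) X =
        pair_sum (fourier_term c (- x)) X - eps * pair_sum (fourier_term c x) X.
      rewrite /pair_sum mulr_sumr -sumrB.
      apply: eq_bigr => n _; rewrite /fourier_term /c' opprK.
      by rewrite !intrN !mulrN !mulNr !opprK; ring.
    by rewrite hpar; ring.
  rewrite (le_trans (cabsB _ _))// cabsM.
  have h1 := h X XX x; have h2 := h X XX (- x).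
  have := ler_wpM2l (cabs_ge0 eps) h1.
  have : e / (1 + cabs eps) + cabs eps * (e / (1 + cabs eps)) = e.
    by field; rewrite gt_eqF// ltr_pwDl// cabs_ge0.
  lra.
have := @fourier_coefficient_le c' _ k 0 hc' k0.
rewrite cabs0 => /(_ (fun=> lexx 0)) h.
apply/eqP; rewrite -subr_eq0; apply/eqP; apply: Normc.eq0_normc.
by apply/eqP; rewrite eq_le cabs_ge0 h.
Qed.

End FourierCoefficients.

(** * The Bessel function *)

Section Bessel.
Context {R : realType}.
Local Notation mu := (@lebesgue_measure R).
Local Notation halfline := (`[(0:R), +oo[%classic).
Implicit Types (s : R[i]) (t u x : R).

Definition coshr t : R := (expR t + expR (- t)) / 2.
Definition sinhr t : R := (expR t - expR (- t)) / 2.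

(** Real and imaginary parts of the integrand that defines the Bessel
    function. *)
Definition bessel_re s u t : R :=
  expR (- (u * coshr t)) * (coshr (Re s * t) * cos (Im s * t)).
Definition bessel_im s u t : R :=
  expR (- (u * coshr t)) * (sinhr (Re s * t) * sin (Im s * t)).

Lemma cexpE (z : R[i]) :
  cexp z = (expR (Re z) * cos (Im z)) +i* (expR (Re z) * sin (Im z)).
Proof. by rewrite /cexp; simpc. Qed.

Lemma ccoshE (z : R[i]) :
  ccosh z = (coshr (Re z) * cos (Im z)) +i* (sinhr (Re z) * sin (Im z)).
Proof.
rewrite /ccosh !cexpE; case: z => a b /=.
rewrite cosN sinN.
have -> : (2 : R[i])^-1 = (2^-1)%:C by rewrite fmorphV rmorph_nat.
by simpc; rewrite /coshr /sinhr; congr (_ +i* _); field.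
Qed.

Lemma bessel_integrandE s u t :
  cexp (- (u%:C * ccosh t%:C)) * ccosh (s * t%:C)
  = bessel_re s u t +i* bessel_im s u t.
Proof.
rewrite !ccoshE cexpE /= cos0 sin0 !mulr1 !mulr0 !mul0r !subr0 !addr0 oppr0.
rewrite cos0 sin0 !mulr0 !mulr1; case: s => a b.
by simpc.
Qed.

Lemma besselKE s u : besselK s u =
  (\int[mu]_(t in halfline) bessel_re s u t) +i*
  (\int[mu]_(t in halfline) bessel_im s u t).
Proof.
by rewrite /besselK /cintegral; congr (_ +i* _); apply: eq_Rintegral => t _;
  rewrite bessel_integrandE.
Qed.

Lemma coshr_ge1 t : 1 <= coshr t.
Proof.
rewrite /coshr expRN; have := expR_gt0 t; set e := expR t => e0.
rewrite ler_pdivlMr// mul1r -subr_ge0.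
have -> : e + e^-1 - 2 = (e - 1) ^+ 2 / e by field; rewrite gt_eqF.
by rewrite divr_ge0 ?sqr_ge0// ltW.
Qed.

Lemma coshr_ge_half_expR t : expR t / 2 <= coshr t.
Proof. by rewrite /coshr ler_pM2r ?invr_gt0// lerDl expR_ge0. Qed.

Lemma coshr_le_expR t : 0 <= t -> coshr t <= expR t.
Proof.
move=> t0; rewrite /coshr ler_pdivrMr// mulr_natr mulr2n lerD2l ler_expR; lra.
Qed.

Lemma normr_coshr_le t : `|coshr t| <= expR `|t|.
Proof.
rewrite ger0_norm; last by rewrite (le_trans _ (coshr_ge1 t)).
rewrite (_ : coshr t = coshr `|t|) ?coshr_le_expR//.
by case: (ger0P t) => // _; rewrite /coshr opprK addrC.
Qed.

Lemma normr_sinhr_le t : `|sinhr t| <= expR `|t|.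
Proof.
have h x : `|sinhr x| <= coshr x.
  rewrite /sinhr /coshr normrM [`|2^-1|]ger0_norm// ler_pM2r ?invr_gt0//.
  by rewrite (le_trans (ler_normB _ _))// !ger0_norm ?expR_ge0.
by rewrite (le_trans (h t))// (le_trans (ler_norm _))// normr_coshr_le.
Qed.

Lemma coshr_homo t x : 0 <= t -> t <= x -> coshr t <= coshr x.
Proof.
move=> t0 tx; rewrite /coshr ler_pM2r ?invr_gt0// -subr_ge0.
have -> : expR x + expR (- x) - (expR t + expR (- t))
  = (expR x - expR t) * (1 - expR (- t - x)).
  rewrite expRD !expRN; field.
  by rewrite !gt_eqF ?expR_gt0.
rewrite mulr_ge0// ?subr_ge0 ?ler_expR//.
rewrite -[leRHS]expR0 ler_expR; lra.
Qed.

Lemma coshr_half_lt t : 0 < t -> coshr (t / 2) < coshr t.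
Proof.
move=> t0; have a1 : 1 < coshr (t / 2).
  rewrite /coshr expRN; set e := expR _.
  have e1 : 1 < e by rewrite /e -expR0 ltr_expR divr_gt0.
  have e0 : 0 < e by rewrite (lt_trans _ e1).
  rewrite ltr_pdivlMr// mul1r -subr_gt0.
  have -> : e + e^-1 - 2 = (e - 1) ^+ 2 / e by field; rewrite gt_eqF.
  by rewrite divr_gt0// exprn_gt0// subr_gt0.
have -> : coshr t = 2 * coshr (t / 2) ^+ 2 - 1.
  rewrite /coshr {1 2}(_ : t = t / 2 + t / 2); last by field.
  rewrite opprD !expRD expRN; field.
  by rewrite gt_eqF ?expR_gt0.
nra.
Qed.

Lemma continuous_coshr : continuous coshr.
Proof.
move=> t; apply: cvgM; last exact: cvg_cst.
apply: cvgD; first exact: continuous_expR.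
apply: continuous_comp; last exact: continuous_expR.
exact: cvgN.
Qed.

Lemma continuous_sinhr : continuous sinhr.
Proof.
move=> t; apply: cvgM; last exact: cvg_cst.
apply: cvgB; first exact: continuous_expR.
apply: continuous_comp; last exact: continuous_expR.
exact: cvgN.
Qed.

Lemma continuous_scale (a : R) : continuous (fun t : R => a * t).
Proof. by move=> t; apply: cvgM; [exact: cvg_cst|exact: cvg_id]. Qed.

Lemma continuous_bessel_factor u : continuous (fun t => expR (- (u * coshr t))).
Proof.
move=> t; apply: (@continuous_comp _ _ _ (fun t => - (u * coshr t)) expR).
  apply: cvgN; apply: cvgM; first exact: cvg_cst.
  exact: continuous_coshr.
exact: continuous_expR.
Qed.

Lemma continuous_bessel_re s u : continuous (bessel_re s u).
Proof.
move=> t; apply: cvgM; first exact: continuous_bessel_factor.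
apply: cvgM.
  by apply: (@continuous_comp _ _ _ (fun t => Re s * t) coshr);
    [exact: continuous_scale|exact: continuous_coshr].
by apply: (@continuous_comp _ _ _ (fun t => Im s * t) cos);
    [exact: continuous_scale|exact: continuous_cos].
Qed.

Lemma continuous_bessel_im s u : continuous (bessel_im s u).
Proof.
move=> t; apply: cvgM; first exact: continuous_bessel_factor.
apply: cvgM.
  by apply: (@continuous_comp _ _ _ (fun t => Re s * t) sinhr);
    [exact: continuous_scale|exact: continuous_sinhr].
by apply: (@continuous_comp _ _ _ (fun t => Im s * t) sin);
    [exact: continuous_scale|exact: continuous_sin].
Qed.

Lemma exp_decay_integrable (r : R) : 0 < r ->
  mu.-integrable halfline (EFin \o (fun t => expR (- r * t))) /\
  \int[mu]_(t in halfline) expR (- r * t) = r^-1.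
Proof.
move=> r0.
have intp : mu.-integrable halfline (EFin \o exponential_pdf r).
  have := integrable_exponential_pdf r0.
  apply: integrableS => //.
have E t : halfline t -> expR (- r * t) = r^-1 * exponential_pdf r t.
  rewrite /= in_itv /= andbT => t0.
  by rewrite exponential_pdfE// mulrA mulVf ?mul1r// gt_eqF.
split.
  apply: (@eq_integrable _ _ _ mu halfline (measurable_itv _)
    (fun t => (r^-1)%:E * (exponential_pdf r t)%:E)%E).
    by move=> t /set_mem ht /=; rewrite E// EFinM.
  exact: integrableZl.
transitivity (\int[mu]_(t in halfline) (r^-1 * exponential_pdf r t)).
  by apply: eq_Rintegral => t /set_mem ht; rewrite -E.
rewrite RintegralZl//.
suff -> : \int[mu]_(t in halfline) exponential_pdf r t = 1 by rewrite mulr1.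
rewrite Rintegral_mkcond.
transitivity (fine 1%E : R) => //.
rewrite -(integral_exponential_pdf r0); congr fine; apply: eq_integral => t _.
rewrite /exponential_pdf patchE; case: ifPn => //= H.
by rewrite patchE (negbTE H).
Qed.

(** All integrals below are dominated by a decaying exponential. *)
Lemma exp_dominated (f : R -> R) (C r : R) : 0 < r -> continuous f ->
  (forall t, 0 <= t -> `|f t| <= C * expR (- r * t)) ->
  mu.-integrable halfline (EFin \o f) /\
  `|\int[mu]_(t in halfline) f t| <= C / r.
Proof.
move=> r0 cf fC; have [intE valE] := exp_decay_integrable r0.
have C0 : 0 <= C.
  by have := le_trans (normr_ge0 _) (fC 0 (lexx 0)); rewrite mulr0 expR0 mulr1.
have intC : mu.-integrable halfline (EFin \o (fun t => C * expR (- r * t))).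
  apply: (@eq_integrable _ _ _ mu halfline (measurable_itv _)
    (fun t => C%:E * (expR (- r * t))%:E)%E).
    by move=> t _ /=; rewrite EFinM.
  exact: integrableZl.
have intf : mu.-integrable halfline (EFin \o f).
  apply: le_integrable intC => //.
    apply/measurable_EFinP; apply: measurable_funTS.
    exact: continuous_measurable_fun.
  move=> t; rewrite /= in_itv /= andbT => t0.
  rewrite lee_fin (le_trans (fC _ t0))// ler_norm//.
split => //.
rewrite (le_trans (le_normr_Rintegral _ intf))//.
rewrite -valE -RintegralZl//.
apply: le_Rintegral => //.
  exact: (integrable_norm intf).
by move=> t; rewrite /= in_itv /= andbT => t0; exact: fC.
Qed.

(** As cosh t >= 1 and cosh t >= exp t / 2, the factor exp (- u cosh t) is at
    most exp (- u / 2) exp (- u exp t / 4), and the second exponential is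
    bounded by a power of its argument, which turns into exp (- k t). *)
Lemma bessel_bound s u t (k : nat) : 0 < u -> 0 <= t ->
  expR (- (u * coshr t)) * expR (`|Re s| * t) <=
  expR (- (u / 2)) * (k%:R ^+ k * 4 ^+ k * u ^- k) *
  expR (- (k%:R - `|Re s|) * t).
Proof.
move=> u0 t0.
have h1 : expR (- (u * coshr t)) <=
    expR (- (u / 2)) * expR (- (u * expR t / 4)).
  rewrite -expRD ler_expR.
  have := coshr_ge1 t; have := coshr_ge_half_expR t; nra.
have h2 : expR (- (u * expR t / 4)) <=
    k%:R ^+ k * 4 ^+ k * u ^- k * expR (- k%:R * t).
  have v0 : 0 < u * expR t / 4 by rewrite divr_gt0 ?mulr_gt0 ?expR_gt0.
  have := expR_ge_pow k (ltW v0); rewrite expRN.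
  set e := expR (_ / _) => h.
  have e0 : 0 < e by exact: expR_gt0.
  have -> : expR (- k%:R * t) = (expR t ^+ k)^-1.
    by rewrite mulNr expRN -expRM_natl.
  have -> : k%:R ^+ k * 4 ^+ k * u ^- k * (expR t ^+ k)^-1 =
      k%:R ^+ k / (u * expR t / 4) ^+ k.
    rewrite !exprMn exprVn !invfM invrK; ring.
  rewrite ler_pdivlMr ?exprn_gt0//.
  by rewrite ler_pdivrMl// [leRHS]mulrC.
rewrite (_ : - (k%:R - `|Re s|) * t = - k%:R * t + `|Re s| * t); last by ring.
rewrite expRD mulrA ler_wpM2r ?expR_ge0// (le_trans h1)// -!mulrA.
by rewrite ler_wpM2l ?expR_ge0// !mulrA.
Qed.

Lemma bessel_re_le s u t : 0 <= t ->
  `|bessel_re s u t| <= expR (- (u * coshr t)) * expR (`|Re s| * t).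
Proof.
move=> t0; rewrite /bessel_re normrM [X in _ * X]normrM ger0_norm ?expR_ge0//.
rewrite ler_wpM2l ?expR_ge0//.
rewrite -[leRHS]mulr1 ler_pM// ?cos_max// (le_trans (normr_coshr_le _))//.
by rewrite normrM (ger0_norm t0).
Qed.

Lemma bessel_im_le s u t : 0 <= t ->
  `|bessel_im s u t| <= expR (- (u * coshr t)) * expR (`|Re s| * t).
Proof.
move=> t0; rewrite /bessel_im normrM [X in _ * X]normrM ger0_norm ?expR_ge0//.
rewrite ler_wpM2l ?expR_ge0//.
rewrite -[leRHS]mulr1 ler_pM// ?sin_max// (le_trans (normr_sinhr_le _))//.
by rewrite normrM (ger0_norm t0).
Qed.

Lemma bessel_integrable s u : 0 < u ->
  mu.-integrable halfline (EFin \o bessel_re s u).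
Proof.
move=> u0; pose k := (Num.truncn `|Re s|).+2.
have ks : 0 < k%:R - `|Re s|.
  by rewrite subr_gt0 (lt_trans (truncnS_gt _))// ltr_nat.
apply: (exp_dominated ks (@continuous_bessel_re s u) _).1 => t t0.
exact: le_trans (bessel_re_le s u t0) (bessel_bound s k u0 t0).
Qed.

(** One estimate for two ranges: exponential decay for large u, and at most
    polynomial growth for u near 0. *)
Lemma besselK_bound s : exists (C : R) (k : nat), 0 < C /\
  forall u, 0 < u -> cabs (besselK s u) <= C * u ^- k * expR (- (u / 2)).
Proof.
pose k := (Num.truncn `|Re s|).+2.
have ks : 0 < k%:R - `|Re s|.
  by rewrite subr_gt0 (lt_trans (truncnS_gt _))// ltr_nat.
pose A : R := k%:R ^+ k * 4 ^+ k.
exists (2 * (A / (k%:R - `|Re s|))), k; split.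
  by rewrite mulr_gt0// divr_gt0// mulr_gt0// exprn_gt0.
move=> u u0; rewrite besselKE (le_trans (cabs_le_ReIm _))//=.
have h1 : `|\int[mu]_(t in halfline) bessel_re s u t| <=
    expR (- (u / 2)) * (A * u ^- k) / (k%:R - `|Re s|).
  apply: (exp_dominated ks (@continuous_bessel_re s u) _).2 => t t0.
  exact: le_trans (bessel_re_le s u t0) (bessel_bound s k u0 t0).
have h2 : `|\int[mu]_(t in halfline) bessel_im s u t| <=
    expR (- (u / 2)) * (A * u ^- k) / (k%:R - `|Re s|).
  apply: (exp_dominated ks (@continuous_bessel_im s u) _).2 => t t0.
  exact: le_trans (bessel_im_le s u t0) (bessel_bound s k u0 t0).
rewrite (le_trans (lerD h1 h2))//.
by rewrite le_eqVlt; apply/orP; left; apply/eqP; ring.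
Qed.

(** Up to t1 the factor cos (Im s * t) is at least cos 1, so the integrand is
    nonnegative there and of size exp (- u cosh (t1 / 2)) on [0, t1 / 2].  Past
    t1 it may be negative, but is smaller than exp (- (u - 1) cosh t1) times an
    integrable function free of u. *)
Lemma bessel_re_pointwise s u (t1 := (1 + `|Im s|)^-1) t : 1 <= u -> 0 <= t ->
  cos 1 * expR (- (coshr (t1 / 2) * u)) * (t <= t1 / 2)%R%:R <=
  bessel_re s u t + expR (- ((u - 1) * coshr t1)) *
    (expR (- (1 * coshr t)) * expR (`|Re s| * t)).
Proof.
move=> u1 t0.
have t1_gt0 : 0 < t1 by rewrite invr_gt0 ltr_pwDl.
have rest_ge0 : 0 <= expR (- ((u - 1) * coshr t1)) *
    (expR (- (1 * coshr t)) * expR (`|Re s| * t)).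
  by rewrite !mulr_ge0 ?expR_ge0.
case: (leP t t1) => tt1; last first.
  have -> : (t <= t1 / 2) = false by apply/negbTE; rewrite -ltNge; lra.
  rewrite mulr0 -lerBlDl sub0r.
  apply: (@le_trans _ _ (expR (- (u * coshr t)) * expR (`|Re s| * t))).
    by rewrite (le_trans _ (bessel_re_le s u t0))// -normrN ler_norm.
  rewrite mulrA ler_wpM2r ?expR_ge0// -expRD ler_expR.
  have := coshr_homo (ltW t1_gt0) (ltW tt1); nra.
have cos1 : cos 1 <= cos (Im s * t).
  have h : `|Im s * t| <= 1.
    rewrite normrM (ger0_norm t0) (le_trans (ler_wpM2l (normr_ge0 _) tt1))//.
    by rewrite /t1 ler_pdivrMr ?mul1r ?lerDr// ltr_pwDl.
  rewrite -(cos_norm (Im s * t)).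
  have pi2 := pi_ge2 R.
  have := h; rewrite le_eqVlt => /predU1P[->//|h1].
  by apply/ltW; rewrite ltr_cos ?in_itv//= ?normr_ge0/= ?ler01/= //; lra.
have cos1_gt0 := cos1_gt0 R.
have re_ge : cos 1 * expR (- (u * coshr t)) <= bessel_re s u t.
  rewrite /bessel_re mulrC ler_wpM2l ?expR_ge0//.
  have := coshr_ge1 (Re s * t); nra.
have [th|th] := leP t (t1 / 2); last first.
  rewrite mulr0 addr_ge0// (le_trans _ re_ge)// mulr_ge0 ?expR_ge0//.
  exact: ltW.
rewrite mulr1; apply: (@le_trans _ _ (bessel_re s u t)); last by rewrite lerDl.
apply: le_trans re_ge.
rewrite ler_pM2l// ler_expR lerN2 mulrC ler_wpM2r ?coshr_homo//.
by rewrite (le_trans _ u1).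
Qed.

(** Integrate [bessel_re_pointwise]; the negative part loses against the
    positive one for large u because cosh (t1 / 2) < cosh t1. *)
Lemma besselK_lower s : exists c kappa B : R, [/\ 0 < c, 0 < kappa, 0 < B &
  forall u, B <= u -> c * expR (- (kappa * u)) <= Re (besselK s u)].
Proof.
(* the range |Im s| t <= 1, on which the cosine is bounded below *)
pose t1 := (1 + `|Im s|)^-1.
have t1_gt0 : 0 < t1 by rewrite invr_gt0 ltr_pwDl.
pose kappa := coshr (t1 / 2); pose delta := coshr t1 - kappa.
have delta_gt0 : 0 < delta by rewrite subr_gt0 coshr_half_lt.
have kappa_gt0 : 0 < kappa by rewrite (lt_le_trans _ (coshr_ge1 _)).
pose bd t := expR (- (1 * coshr t)) * expR (`|Re s| * t).
have bd_ge0 t : 0 <= bd t by rewrite mulr_ge0 ?expR_ge0.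
have bdint : mu.-integrable halfline (EFin \o bd).
  pose k := (Num.truncn `|Re s|).+2.
  have ks : 0 < k%:R - `|Re s|.
    by rewrite subr_gt0 (lt_trans (truncnS_gt _))// ltr_nat.
  have cbd : continuous bd.
    move=> t; apply: cvgM; first exact: continuous_bessel_factor.
    by apply: (@continuous_comp _ _ _ (fun t => `|Re s| * t) expR);
      [exact: continuous_scale|exact: continuous_expR].
  apply: (exp_dominated ks cbd _).1 => t t0.
  by rewrite ger0_norm//; apply: bessel_bound.
pose D := \int[mu]_(t in halfline) bd t.
have D_ge0 : 0 <= D by apply: Rintegral_ge0.
have cos1_gt0 := cos1_gt0 R.
pose c := cos 1 * (t1 / 2).
have c_gt0 : 0 < c by rewrite mulr_gt0// divr_gt0.
have key u : 1 <= u -> c * expR (- (kappa * u)) <=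
    Re (besselK s u) + expR (- ((u - 1) * coshr t1)) * D.
  move=> u1; have u0 : 0 < u by rewrite (lt_le_trans _ u1).
  pose e := expR (- ((u - 1) * coshr t1)).
  have intre := bessel_integrable s u0.
  have intb : mu.-integrable halfline (EFin \o (fun t => e * bd t)).
    apply: (@eq_integrable _ _ _ mu halfline (measurable_itv _)
      (fun t => e%:E * (bd t)%:E)%E).
      by move=> t _ /=; rewrite EFinM.
    exact: integrableZl.
  pose f t := bessel_re s u t + e * bd t.
  have intf : mu.-integrable halfline (EFin \o f).
    apply: (@eq_integrable _ _ _ mu halfline (measurable_itv _)
      (fun t => (bessel_re s u t)%:E + (e * bd t)%:E)%E).
      by move=> t _ /=; rewrite EFinD.
    exact: integrableD.
  have -> : Re (besselK s u) + e * D = \int[mu]_(t in halfline) f t.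
    by rewrite besselKE /= /f RintegralD// RintegralZl.
  have t2_gt0 : 0 < t1 / 2 by rewrite divr_gt0.
  have := @Rintegral_itvB R f (BLeft 0) +oo%O (t1 / 2) intf.
  rewrite !bnd_simp (ltW t2_gt0) => /(_ isT isT) split.
  have tail : 0 <= \int[mu]_(x in `]t1 / 2, +oo[%classic) f x.
    apply: Rintegral_ge0 => t; rewrite /= in_itv/= andbT => tt.
    have : cos 1 * expR (- (kappa * u)) * (t <= t1 / 2)%R%:R <= f t.
      exact: bessel_re_pointwise (ltW (lt_trans t2_gt0 tt)).
    by rewrite (leNgt t) tt/= mulr0.
  have head : c * expR (- (kappa * u)) <=
      \int[mu]_(x in `[0, t1 / 2]%classic) f x.
    have -> : c * expR (- (kappa * u)) =
        \int[mu]_(x in `[0, t1 / 2]%classic) (cos 1 * expR (- (kappa * u))).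
      rewrite Rintegral_cst//= lebesgue_measure_itv/= lte_fin t2_gt0/= subr0.
      by rewrite /c mulrAC.
    apply: le_Rintegral => //.
    - apply: continuous_compact_integrable; first exact: segment_compact.
      by apply: continuous_subspaceT => x; exact: cvg_cst.
    - by apply: integrableS intf => //; apply: subset_itvl.
    move=> t; rewrite /= in_itv/= => /andP[t0 tt].
    have : cos 1 * expR (- (kappa * u)) * (t <= t1 / 2)%R%:R <= f t.
      exact: bessel_re_pointwise.
    by rewrite tt mulr1.
  by move: split => /eqP; rewrite subr_eq => /eqP ->; rewrite ler_wpDl.
pose D' := D * expR (coshr t1).
have D'_ge0 : 0 <= D' by rewrite mulr_ge0 ?expR_ge0.
exists (c / 2), kappa, (1 + 2 * D' / (delta * c)).
have B_ge0 : 0 <= 2 * D' / (delta * c).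
  by rewrite divr_ge0 ?mulr_ge0// ltW.
split=> //; [by rewrite divr_gt0|by rewrite ltr_pwDl|].
move=> u Bu; have u1 : 1 <= u by rewrite (le_trans _ Bu)// lerDl.
have := key _ u1.
have -> : expR (- ((u - 1) * coshr t1)) * D =
    expR (- (kappa * u)) * (D' * expR (- (delta * u))).
  have -> : expR (- ((u - 1) * coshr t1)) =
      expR (coshr t1) * (expR (- (kappa * u)) * expR (- (delta * u))).
    by rewrite -!expRD; congr expR; rewrite /delta; ring.
  rewrite /D'; ring.
suff h : D' * expR (- (delta * u)) <= c / 2.
  rewrite -lerBlDr; apply: le_trans.
  have := expR_gt0 (- (kappa * u)); nra.
have du : 0 < delta * u by rewrite mulr_gt0// (lt_le_trans _ u1).
rewrite expRN ler_pdivrMr ?expR_gt0//.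
have : 1 + delta * u <= expR (delta * u) by exact: expR_ge1Dx.
have : 2 * D' / (delta * c) <= u by rewrite (le_trans _ Bu)// lerDr.
rewrite ler_pdivrMr ?mulr_gt0//; nra.
Qed.

End Bessel.

(** * The modular group *)

Section Modular.
Context {R : realType}.
Implicit Types (g : R[i] -> R[i]) (x y : R).

Definition modular_invariant g := forall A : 'M[int]_2, \det A = 1 ->
  forall z, upper z -> g (moebius A z) = g z.

Lemma modular_fraction g (p q r t : int) z : modular_invariant g ->
  p * t - q * r = 1 -> upper z ->
  g ((p%:~R * z + q%:~R) / (r%:~R * z + t%:~R)) = g z.
Proof.
move=> hg det1 hz.
pose A : 'M[int]_2 := \matrix_(i, j)
  if i == ord0 then (if j == ord0 then p else q)
  else (if j == ord0 then r else t).
rewrite -[RHS](hg A)//; first by rewrite /moebius !mxE.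
rewrite (expand_det_row _ ord0) !big_ord_recl big_ord0 /cofactor !det_mx11 !mxE.
rewrite /= expr0 expr1.
lia.
Qed.

Lemma intr_complex (k : int) : (k%:~R : R[i]) = (k%:~R : R)%:C.
Proof. by rewrite rmorph_int. Qed.

Lemma modular_translate g x y (k : int) : modular_invariant g -> 0 < y ->
  g ((x + k%:~R) +i* y) = g (x +i* y).
Proof.
move=> hg y0; rewrite -(@modular_fraction g 1 k 0 1 (x +i* y))
  ?mulr0 ?subr0 ?mulr1//.
rewrite mul0r add0r divr1 mul1r intr_complex; congr (g _).
by simpc.
Qed.

Lemma complex_div_eq (w z d : R[i]) : d != 0 -> w * d = z -> z / d = w.
Proof. by move=> d0 <-; rewrite mulfK. Qed.

Lemma modular_inversion g x y : modular_invariant g -> 0 < y ->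
  g ((- x / (x ^+ 2 + y ^+ 2)) +i* (y / (x ^+ 2 + y ^+ 2))) = g (x +i* y).
Proof.
move=> hg y0; rewrite -(@modular_fraction g 0 (-1) 1 0 (x +i* y))//.
have n0 : x ^+ 2 + y ^+ 2 != 0.
  by rewrite gt_eqF// ltr_wpDl ?sqr_ge0// exprn_gt0.
congr (g _); apply/esym/complex_div_eq.
  by rewrite mul1r addr0 eq_complex/= negb_and orbC gt_eqF.
rewrite mul0r add0r mul1r addr0.
by rewrite intr_complex; simpc; congr (_ +i* _); field.
Qed.

(** With j' / c the reduced fraction and u j' + v c = 1, the matrix with rows
    (-u, -v) and (c, -j') sends j / q + i y to height 1 / (c^2 y). *)
Lemma modular_cusp g (j q : nat) y :
  modular_invariant g -> 0 < y -> (0 < q)%N ->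
  exists x' y' : R, [/\ 0 < y', g ((j%:R / q%:R) +i* y) = g (x' +i* y') &
    1 <= y' * (q%:R ^+ 2 * y)].
Proof.
move=> hg y0 q0.
pose d := gcdn j q; have d0 : (0 < d)%N by rewrite gcdn_gt0 q0 orbT.
pose j' := (j %/ d)%N; pose c := (q %/ d)%N.
have qE : q = (c * d)%N by rewrite divnK// dvdn_gcdr.
have jE : j = (j' * d)%N by rewrite divnK// dvdn_gcdl.
have c0 : (0 < c)%N by move: q0; rewrite qE muln_gt0 => /andP[].
have cop : coprimez j'%:Z c%:Z.
  by rewrite coprimezE/= /coprime -(eqn_pmul2r d0) muln_gcdl -jE -qE mul1n.
have /coprimezP[[u v] /= uv] := cop.
have cR : (0 : R) < c%:R by rewrite ltr0n.
have dR : (0 : R) < d%:R by rewrite ltr0n.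
have xE : j%:R / q%:R = j'%:R / c%:R :> R.
  by rewrite qE jE !natrM invfM mulrACA divff ?mulr1// gt_eqF.
have uvR : u%:~R * j'%:R + v%:~R * c%:R = 1 :> R.
  by rewrite !pmulrn -!intrM -intrD uv.
exists (- u%:~R / c%:R), (1 / (c%:R ^+ 2 * y)).
have w0 : 0 < 1 / (c%:R ^+ 2 * y) by rewrite divr_gt0// mulr_gt0// exprn_gt0.
split=> //.
  rewrite -(@modular_fraction g (- u) (- v) c (- j'%:Z) _ hg)//; last first.
    by rewrite mulrN mulNr opprK mulNr opprK [v * _]mulrC; lia.
  rewrite xE; congr (g _); apply: complex_div_eq.
    rewrite !intr_complex; simpc; rewrite eq_complex/= negb_and.
    by rewrite [X in _ || X]mulf_neq0 ?orbT// gt_eqF.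
  rewrite !intr_complex; simpc; rewrite !intrN -!pmulrn.
  have -> : v%:~R = (1 - u%:~R * j'%:R) / c%:R :> R.
    by apply: (canRL (mulfK _)); [rewrite gt_eqF|lra].
  by congr (_ +i* _); field; rewrite !gt_eqF.
rewrite mul1r mulrC ler_pdivlMr ?mulr_gt0 ?exprn_gt0// mul1r.
rewrite ler_pM2r// lerXn2r ?nnegrE ?ler0n// ler_nat qE.
by rewrite leq_pmulr.
Qed.

End Modular.

(** * Growth of the coefficients and decay of the form *)

Section FourierGrowth.
Context {R : realType} (nu : R[i]) (g : R[i] -> R[i]) (a : int -> R[i]).
Context (g_inv : modular_invariant g) (g_four : maass_fourier_expansion nu a g).
Implicit Types x y u : R.

Local Notation K := (besselK ('i%C * nu)).

(** The Fourier coefficients of the restriction of the form to the horizontal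
    line at height y. *)
Definition maass_coef y (n : int) : R[i] :=
  a n * (Num.sqrt y)%:C * K (2 * pi * `|n|%:~R * y).

Lemma maass_fourier_series y : 0 < y ->
  fourier_series (maass_coef y) (fun x => g (x +i* y)).
Proof.
move=> y0 x; have := g_four (z := x +i* y) y0.
rewrite (_ : maass_fourier_term nu a (x +i* y) =
  fourier_term (maass_coef y) x)//.
apply/funext => n; rewrite /maass_fourier_term /fourier_term /maass_coef /=.
congr (_ * _); rewrite /cexp /circ intr_complex.
have -> : (2 : R[i]) = (2 : R)%:C by rewrite rmorph_nat.
by simpc; rewrite /= expR0 !mul1r -!mulrA.
Qed.

Lemma pair_abs_maass_coef y (n : nat) :
  pair_abs (maass_coef y) n =
  pair_abs a n * Num.sqrt y * cabs (K (2 * pi * n%:R * y)).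
Proof.
rewrite /pair_abs /maass_coef !cabsM !cabs_real ger0_norm ?sqrtr_ge0//.
by rewrite normrN -!mulrDl.
Qed.

(** At a small fixed height y the terms of the expansion are bounded, and the
    Bessel factor is at least a multiple of exp (- 2 pi kappa n y); y is chosen
    so that 2 pi kappa y = e. *)
Lemma coef_subexponential (e : R) : 0 < e ->
  exists2 C : R, 0 < C & forall n : nat, pair_abs a n <= C * expR (e * n%:R).
Proof.
move=> e0; have [c [kappa [B [c0 k0 B0 hK]]]] := besselK_lower ('i%C * nu).
have pi0 := pi_gt0 R.
pose y := e / (2 * pi * kappa).
have y0 : 0 < y by rewrite divr_gt0// !mulr_gt0.
have sy0 : 0 < Num.sqrt y by rewrite sqrtr_gt0.
have [X0 hX0] := fourier_series_tail_small (maass_fourier_series y0) ltr01.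
pose N := maxn X0.+1 (Num.truncn (B / (2 * pi * y))).+1.
have [n nN|C C0 hC] := @eventually_bounded R
   (fun n => pair_abs a n * expR (- (e * n%:R))) N (1 / (Num.sqrt y * c)).
  have nX : (X0 < n)%N by rewrite (leq_trans _ nN)// leq_maxl.
  have Bn : B <= 2 * pi * n%:R * y.
    have py0 : 0 < 2 * pi * y by apply: mulr_gt0 => //; exact: mulr_gt0.
    rewrite mulrAC -ler_pdivrMl// mulrC; apply/ltW.
    rewrite (lt_le_trans (truncnS_gt _))// ler_nat.
    by rewrite (leq_trans _ nN)// leq_maxr.
  have hn : pair_abs (maass_coef y) n <= 1.
    have := hX0 X0 (leqnn _) n.+1.
    rewrite big_nat_recr//=; apply: le_trans; rewrite lerDr.
    by apply: sumr_ge0 => k _; exact: pair_abs_ge0.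
  have Kn : c * expR (- (e * n%:R)) <= cabs (K (2 * pi * n%:R * y)).
    have := hK _ Bn.
    rewrite (_ : kappa * _ = e * n%:R); last first.
      have -> : e = y * (2 * pi * kappa) by rewrite divfK// gt_eqF// !mulr_gt0.
      by ring.
    move=> h; rewrite (le_trans h)// (le_trans (ler_norm _))//.
    exact: Re_le_cabs.
  rewrite ler_pdivlMr ?mulr_gt0//.
  apply: le_trans hn; rewrite pair_abs_maass_coef.
  have -> : pair_abs a n * expR (- (e * n%:R)) * (Num.sqrt y * c) =
    pair_abs a n * Num.sqrt y * (c * expR (- (e * n%:R))) by ring.
  by rewrite ler_wpM2l// mulr_ge0 ?pair_abs_ge0 ?ltW.
exists C => // n; have := hC n.
by rewrite expRN ler_pdivrMr ?expR_gt0.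
Qed.

Lemma sqrt_le_double y : 1 / 2 <= y -> Num.sqrt y <= 2 * y.
Proof.
move=> y12; have y0 : 0 <= 2 * y by lra.
rewrite -[leRHS]ger0_norm// -sqrtr_sqr ler_sqrt ?sqr_ge0//; nra.
Qed.

(** The Bessel factor exp (- pi n y) beats the growth exp (n / 4) allowed for
    the coefficients, and leaves exp (- y) exp (- n / 4) to spare. *)
Lemma form_decay_high (p : nat) : exists2 C : R, 0 < C &
  forall x y, 1 / 2 <= y -> cabs (g (x +i* y)) * y ^+ p <= C.
Proof.
have e0 : (0 : R) < 1 / 4 by lra.
have [C1 C10 hC1] := coef_subexponential e0.
have [C2 [k [C20 hC2]]] := besselK_bound ('i%C * nu).
have pi2 := pi_ge2 R.
pose P : R := p.+1%:R ^+ p.+1.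
have P0 : 0 < P by rewrite exprn_gt0.
(* 64 from exp (- n / 4) <= 64 / n^2, 2 from sqrt y <= 2 y, and 2 bounds the sum
   of 1 / n^2 *)
exists (256 * (C1 * C2 * P)); first by rewrite !mulr_gt0.
move=> x y y12; have y0 : 0 < y by lra.
have yp0 : 0 < y ^+ p by rewrite exprn_gt0.
rewrite -ler_pdivlMr//.
pose d (n : nat) := C1 * C2 * (2 * P / y ^+ p) * (64 * n%:R ^- 2).
have dn (n : nat) : (0 < n)%N -> pair_abs (maass_coef y) n <= d n.
  move=> n0; have n1 : (1 : R) <= n%:R by rewrite ler1n.
  rewrite pair_abs_maass_coef.
  set u := 2 * pi * n%:R * y.
  have ny : n%:R / 2 <= n%:R * y by nra.
  have yny : y <= n%:R * y by nra.
  have u2 : 2 * (2 * (n%:R * y)) <= u.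
    by rewrite /u -!mulrA ler_pM2l// ler_wpM2r// mulr_ge0// ltW.
  have u0 : 0 < u by nra.
  have Ku : cabs (K u) <= C2 * (expR (- (n%:R / 2)) * expR (- y)).
    rewrite (le_trans (hC2 _ u0))// -mulrA ler_pM2l// -expRD.
    rewrite -[leRHS]mul1r ler_pM ?expR_ge0 ?invr_ge0 ?exprn_ge0 ?(ltW u0)//.
      by rewrite invf_le1 ?exprn_gt0// exprn_ege1//; nra.
    rewrite ler_expR; lra.
  have sy : Num.sqrt y * expR (- y) <= 2 * P / y ^+ p.
    rewrite ler_pdivlMr// expRN mulrAC ler_pdivrMr ?expR_gt0//.
    have := expR_ge_pow p.+1 (ltW y0); rewrite -/P exprS => hP.
    have := ler_wpM2r (ltW yp0) (sqrt_le_double y12); lra.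
  have hn := hC1 n.
  have ee : expR (1 / 4 * n%:R) * expR (- (n%:R / 2)) <= 64 * n%:R ^- 2 :> R.
    apply: le_trans (expRN_le_inv_sqr n0).
    rewrite -expRD ler_expR; lra.
  rewrite /d.
  apply: (@le_trans _ _ ((C1 * expR (1 / 4 * n%:R)) * Num.sqrt y *
      (C2 * (expR (- (n%:R / 2)) * expR (- y))))).
    rewrite ler_pM ?mulr_ge0 ?pair_abs_ge0 ?sqrtr_ge0 ?cabs_ge0//.
    by rewrite ler_wpM2r ?sqrtr_ge0.
  have -> : C1 * expR (1 / 4 * n%:R) * Num.sqrt y *
     (C2 * (expR (- (n%:R / 2)) * expR (- y))) =
     C1 * C2 * (Num.sqrt y * expR (- y)) *
     (expR (1 / 4 * n%:R) * expR (- (n%:R / 2))) by ring.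
  have C120 : 0 <= C1 * C2 by rewrite mulr_ge0// ltW.
  apply: ler_pM => //; last by rewrite ler_wpM2l.
  by rewrite mulr_ge0// mulr_ge0 ?sqrtr_ge0 ?expR_ge0.
have tl : tail_le (maass_coef y) 0 (256 * (C1 * C2 * P) / y ^+ p).
  move=> Y; apply: (@le_trans _ _ (\sum_(1 <= n < Y) d n)).
    by apply: ler_sum_nat => n /andP[n0 _]; exact: dn.
  rewrite /d -mulr_sumr -mulr_sumr.
  have A0 : 0 <= C1 * C2 * (2 * P / y ^+ p).
    by rewrite !mulr_ge0 ?invr_ge0// ltW.
  have := @sum_inv_sqr R Y => hs.
  have h := ler_wpM2l A0 (ler_wpM2l (ler0n R 64) hs).
  rewrite (le_trans h)// le_eqVlt; apply/orP; left; apply/eqP; ring.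
have := fourier_series_approx (maass_fourier_series y0) tl x.
by rewrite /pair_sum big_geq// subr0.
Qed.

(** If y < 1 / 2, translate to |x| <= 1 / 2 and apply z |-> -1/z: as
    x^2 + y^2 <= 1 / 2, the height at least doubles.  After finitely many steps
    the height is at least 1 / 2. *)
Lemma form_bounded : exists2 M : R, 0 < M &
  forall x y, 0 < y -> cabs (g (x +i* y)) <= M.
Proof.
have [M M0 hM] := form_decay_high 0.
exists M => // x y y0.
have [m hm] : exists m : nat, 2 ^- m <= y.
  exists (Num.truncn y^-1).+1.
  rewrite invf_ple ?posrE ?exprn_gt0// ltW//.
  rewrite (lt_le_trans (truncnS_gt _))// -natrX ler_nat ltnW// ltn_expl//.
elim: m x y y0 hm => [|m IH] x y y0 hm.
  have := hM x y; rewrite expr0 mulr1; apply.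
  by move: hm; rewrite expr0 invr1; lra.
have [y12|y12] := leP (1 / 2) y.
  by have := hM x y y12; rewrite expr0 mulr1.
pose k := Num.floor (x + 1 / 2); pose x' := x - k%:~R.
have xk : `|x'| <= 1 / 2.
  have := floor_itv (x + 1 / 2); rewrite -/k intrD => /andP[h1 h2].
  by rewrite ler_norml /x'; apply/andP; split; move: h1 h2; rewrite ?intrD; lra.
have -> : g (x +i* y) = g (x' +i* y).
  by rewrite -(modular_translate x' k g_inv y0) subrK.
rewrite -(modular_inversion x' g_inv y0).
have x2 : x' ^+ 2 <= 1 / 4.
  have := ler_pM (normr_ge0 x') (normr_ge0 x') xk xk.
  by rewrite -expr2 real_normK ?num_real//; lra.
have n0 : 0 < x' ^+ 2 + y ^+ 2 by rewrite ltr_wpDl ?sqr_ge0// exprn_gt0.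
apply: IH; first by rewrite divr_gt0.
rewrite ler_pdivlMr//.
have : 2 ^- m = 2 * 2 ^- m.+1 :> R.
  by rewrite exprS invfM mulrA divff// mul1r.
move=> ->; nra.
Qed.

Lemma form_decay (p : nat) : exists2 C : R, 0 < C &
  forall x y, 0 < y -> cabs (g (x +i* y)) * y ^+ p <= C.
Proof.
have [M M0 hM] := form_bounded.
have [C C0 hC] := form_decay_high p.
exists (M + C); first lra.
move=> x y y0; have [y12|y12] := leP (1 / 2) y.
  by have := hC x y y12; lra.
apply: (@le_trans _ _ (M * 1)); last lra.
by rewrite ler_pM ?cabs_ge0 ?hM ?exprn_ge0 ?(ltW y0)// exprn_ile1//; lra.
Qed.

End FourierGrowth.

(** * Testing the form near a cusp *)

Section DirichletKernel.
Context {R : realType}.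

Lemma dirichlet_le (w : R[i]) (L : nat) : cabs w = 1 ->
  cabs (\sum_(j < L) w ^+ j) <= L%:R.
Proof.
move=> w1; rewrite (le_trans (cabs_sum _ _ _))//.
under eq_bigr do rewrite cabsX w1 expr1n.
by rewrite sumr_const card_ord.
Qed.

Lemma dirichlet_chord (w : R[i]) (L : nat) : cabs w = 1 ->
  cabs (1 - w) * cabs (\sum_(j < L) w ^+ j) <= 2.
Proof.
move=> w1; rewrite -cabsM -cabsN -mulNr opprB -subrX1.
by rewrite (le_trans (cabsB _ _))// cabsX w1 expr1n cabs1.
Qed.

(** The m L coefficients of the m-th power of a Dirichlet kernel are
    nonnegative with sum L^m, so the largest one is at least L^m / (m L). *)
Lemma dirichlet_power (m L : nat) : (0 < m)%N -> (0 < L)%N ->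
  exists tau : nat -> R, [/\ forall k, 0 <= tau k,
    forall w : R[i], \sum_(k < m * L) (tau k)%:C * w ^+ k =
      (\sum_(j < L) w ^+ j) ^+ m &
    exists2 k, (k < m * L)%N & L%:R ^+ m <= (m * L)%:R * tau k].
Proof.
move=> m0 L0; pose D : {poly R} := \sum_(j < L) 'X^j.
have szD : (size D <= L)%N.
  rewrite (leq_trans (size_sum _ _ _))//; apply/bigmax_leqP => j _.
  by rewrite size_polyXn.
have szP : (size (D ^+ m) <= m * L)%N.
  case: m m0 => // m _; elim: m => [|m IH]; first by rewrite expr1 mul1n.
  rewrite exprS (leq_trans (size_polyMleq _ _))//.
  rewrite (leq_trans (leq_pred _))// mulSn; exact: leq_add.
have tau0 k : 0 <= (D ^+ m)`_k.
  elim: m k {m0 szP} => [|m IH] k; first by rewrite expr0 coefC; case: ifP.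
  rewrite exprS coefM sumr_ge0// => i _; rewrite mulr_ge0//.
  by rewrite coef_sum sumr_ge0// => j _; rewrite coefXn ler0n.
exists (fun k => (D ^+ m)`_k).
have ev (w : R[i]) : \sum_(k < m * L) ((D ^+ m)`_k)%:C * w ^+ k =
      (\sum_(j < L) w ^+ j) ^+ m.
  transitivity (map_poly (real_complex R) (D ^+ m)).[w].
    rewrite (@horner_coef_wide _ (m * L)); last first.
      by rewrite size_map_poly.
    by apply: eq_bigr => k _; rewrite coef_map.
  rewrite rmorphXn horner_exp rmorph_sum horner_sum; congr (_ ^+ m).
  by apply: eq_bigr => j _; rewrite /= map_polyXn hornerXn.
split=> //.
have sum1 : \sum_(k < m * L) (D ^+ m)`_k = L%:R ^+ m.
  have := ev 1; under [X in _ = X ^+ _]eq_bigr do rewrite expr1n.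
  rewrite sumr_const card_ord -(rmorph_nat (real_complex R)) -rmorphXn.
  move=> /(congr1 (@complex.Re R)); rewrite Re_sum /= => <-.
  by apply: eq_bigr => k _; rewrite expr1n mulr1.
have mL0 : (0 < m * L)%N by rewrite muln_gt0 m0.
apply: contrapT => H.
have : \sum_(k < m * L) (m * L)%:R * (D ^+ m)`_k <
       \sum_(k < m * L) L%:R ^+ m.
  apply: ltr_sum.
    by apply/hasP; exists (Ordinal mL0); rewrite ?mem_index_enum.
  move=> k _; rewrite ltNge; apply/negP => h; apply: H.
  by exists k.
by rewrite -mulr_sumr sum1 sumr_const card_ord mulr_natl ltxx.
Qed.

End DirichletKernel.

Section HoroballDecay.
Context {R : realType} (nu : R[i]) (g : R[i] -> R[i]) (a : int -> R[i]).
Context (g_inv : modular_invariant g) (g_four : maass_fourier_expansion nu a g).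
Implicit Types x y u : R.

(** At distance |x| from the nearest integer the form is
    O(((x^2 + y^2) / y)^p), while the kernel is at most L and at most a
    multiple of 1 / |x|; its power 2 p compensates the growth of the form away
    from the cusp. *)
Lemma form_times_dirichlet (p : nat) : exists2 C : R, 0 < C &
  forall x y (L : nat), 0 < y ->
    cabs (g (x +i* y)) * cabs (\sum_(j < L) circ (- x) ^+ j) ^+ (2 * p) * y ^+ p
    <= C * (4 / cos 1 ^+ 2 + (y * L%:R) ^+ 2) ^+ p.
Proof.
have [C C0 hC] := form_decay g_inv g_four p.
exists C => // x y L y0.
pose k := Num.floor (x + 1 / 2); pose x' := x - k%:~R.
have xk : `|x'| <= 1 / 2.
  have := floor_itv (x + 1 / 2); rewrite -/k intrD => /andP[h1 h2].
  by rewrite ler_norml /x'; apply/andP; split; move: h1 h2; rewrite ?intrD; lra.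
have -> : g (x +i* y) = g (x' +i* y).
  by rewrite -(modular_translate x' k g_inv y0) subrK.
have -> : circ (- x) = circ (- x').
  by rewrite /x' opprB circD circ_int mul1r.
set E := cabs (\sum_(j < L) _).
have E0 : 0 <= E by exact: cabs_ge0.
have E1 : E <= L%:R by apply: dirichlet_le; exact: cabs_circ.
have c1 := cos1_gt0 R.
have E2 : cos 1 * (`|x'| * E) <= 2.
  apply: le_trans (@dirichlet_chord R (circ (- x')) L (cabs_circ _)).
  rewrite mulrA ler_wpM2r// -(normrN x') circ_chord_lower// normrN//.
have n0 : 0 < x' ^+ 2 + y ^+ 2 by rewrite ltr_wpDl ?sqr_ge0// exprn_gt0.
have w0 : 0 < y / (x' ^+ 2 + y ^+ 2) by rewrite divr_gt0.
have := hC (- x' / (x' ^+ 2 + y ^+ 2)) _ w0.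
rewrite modular_inversion// exprMn exprVn mulrA ler_pdivrMr ?exprn_gt0// => hg.
rewrite mulrAC exprM.
apply: (@le_trans _ _ (C * (x' ^+ 2 + y ^+ 2) ^+ p * (E ^+ 2) ^+ p)).
  by rewrite ler_wpM2r ?exprn_ge0.
rewrite -mulrA -exprMn ler_pM2l//.
have n1 : 0 <= (x' ^+ 2 + y ^+ 2) * E ^+ 2 by rewrite mulr_ge0 ?sqr_ge0// ltW.
have n2 : 0 <= 4 / cos 1 ^+ 2 + (y * L%:R) ^+ 2.
  by rewrite addr_ge0 ?sqr_ge0// divr_ge0 ?sqr_ge0.
rewrite lerXn2r ?nnegrE//.
rewrite mulrDl lerD//.
  rewrite ler_pdivlMr ?exprn_gt0//.
  rewrite -(real_normK (num_real x')) -!exprMn -[4]/(2 * 2)%:R natrM -expr2.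
  rewrite lerXn2r ?nnegrE ?mulr_ge0// ?(ltW c1)//.
  by rewrite mulrC.
by rewrite -exprMn lerXn2r ?nnegrE ?mulr_ge0 ?(ltW y0)// ler_wpM2l// ltW.
Qed.

End HoroballDecay.

(** * Coefficients of eventually constant sign *)

Section EventualSign.
Context {R : realType} (nu : R[i]) (g : R[i] -> R[i]) (a : int -> R[i]).
Context (g_inv : modular_invariant g) (g_four : maass_fourier_expansion nu a g).
Implicit Types x y u : R.

Local Notation K := (besselK ('i%C * nu)).
Local Notation coef := (maass_coef nu a).

(** The parity of the form is inherited by the numbers a_n sqrt(y) K, and K
    does not vanish at large arguments. *)
Lemma coef_parity (eps : R[i]) :
  (forall x y, 0 < y -> g ((- x) +i* y) = eps * g (x +i* y)) ->
  forall n : nat, (0 < n)%N -> a (- n%:Z) = eps * a n%:Z.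
Proof.
move=> hpar n n0.
have [c [kappa [B [c0 k0 B0 hK]]]] := besselK_lower ('i%C * nu).
have n0R : (0 : R) < n%:R by rewrite ltr0n.
have pin : 0 < 2 * pi * n%:R :> R by rewrite !mulr_gt0// pi_gt0.
pose y := B / (2 * pi * n%:R).
have y0 : 0 < y by rewrite divr_gt0.
have := parity_coefficients
  (fourier_series_uniform (maass_fourier_series g_four y0))
  (k := n%:Z) n0 (fun x => hpar x y y0).
rewrite /maass_coef normrN.
have K0 : K (2 * pi * `|n%:Z|%:~R * y) != 0.
  have : 0 < Re (K (2 * pi * `|n%:Z|%:~R * y)).
    apply: lt_le_trans (hK _ _); first by rewrite mulr_gt0 ?expR_gt0.
    by rewrite /= [leRHS]mulrC divfK// gt_eqF.
  by apply: contraTneq => ->; rewrite ltxx.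
have s0 : (Num.sqrt y)%:C != 0 :> R[i].
  by rewrite eq_complex/= eqxx andbT gt_eqF// sqrtr_gt0.
move: (K _) K0 (_%:C) s0 => kv kv0 sv sv0; rewrite !mulrA => H.
exact: (mulIf sv0 (mulIf kv0 H)).
Qed.

Lemma Re_maass_coef y (n : nat) : a n%:Z \is Num.real ->
  Re (coef y n%:Z) = Re (a n%:Z) * Num.sqrt y * Re (K (2 * pi * n%:R * y)).
Proof.
by move=> h; rewrite /maass_coef -{1}(RRe_real h) -mulrA !Re_scale mulrA.
Qed.

(** The kernel is modulated by e(- N1 x), which places its frequencies above
    N1. *)
Lemma sum_dirichlet_shift (D N1 : nat) (tau : nat -> R) x :
  \sum_(k < D) (tau k)%:C * circ (- ((N1 + k)%N%:Z)%:~R * x) =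
  circ (- N1%:R * x) * \sum_(k < D) (tau k)%:C * circ (- x) ^+ k.
Proof.
rewrite mulr_sumr; apply: eq_bigr => k _; rewrite mulrCA; congr (_ * _).
rewrite -circMn -circD; congr circ; rewrite -pmulrn natrD; ring.
Qed.

(** Every summand has a real part of the sign sg, so the sum is at least as
    large as its term of index k1. *)
Lemma window_lower_bound (sg B y : R) (N0 N1 D k1 : nat) (tau : nat -> R) :
  `|sg| = 1 ->
  (forall n : nat, (1 <= n)%N -> a n%:Z \is Num.real) ->
  (forall n : nat, (N0 <= n)%N -> 0 <= sg * Re (a n%:Z)) ->
  (forall u, B <= u -> 0 < Re (K u)) -> (forall k, 0 <= tau k) -> 0 < y ->
  (N0 <= N1)%N -> (0 < N1)%N -> (k1 < D)%N -> B <= 2 * pi * N1%:R * y ->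
  tau k1 * (cabs (a (N1 + k1)%N%:Z) * Num.sqrt y *
    Re (K (2 * pi * (N1 + k1)%N%:R * y)))
  <= cabs (\sum_(k < D) (tau k)%:C * coef y (N1 + k)%N%:Z).
Proof.
move=> sg1 a_real a_sign Kpos tau0 y0 N1N0 N10 k1D BN1.
have pi0 := pi_gt0 R.
have a_re k : a (N1 + k)%N%:Z \is Num.real.
  by apply: a_real; rewrite addn_gt0 N10.
have a_sg k : 0 <= sg * Re (a (N1 + k)%N%:Z).
  by apply: a_sign; rewrite (leq_trans N1N0)// leq_addr.
have K0 k : 0 < Re (K (2 * pi * (N1 + k)%N%:R * y)).
  apply: Kpos; apply: le_trans BN1 _; rewrite ler_pM2r// ler_pM2l ?mulr_gt0//.
  by rewrite ler_nat leq_addr.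
have termE k : sg * Re ((tau k)%:C * coef y (N1 + k)%N%:Z) =
    tau k * (sg * Re (a (N1 + k)%N%:Z) * Num.sqrt y *
    Re (K (2 * pi * (N1 + k)%N%:R * y))).
  rewrite (Re_scale (tau k)) Re_maass_coef//.
  by move: (Re _) (Re _) => A1 A2; ring.
have term0 k : 0 <= sg * Re ((tau k)%:C * coef y (N1 + k)%N%:Z).
  rewrite termE; apply: mulr_ge0; first exact: tau0.
  apply: mulr_ge0; last exact: ltW.
  by apply: mulr_ge0; last exact: sqrtr_ge0.
have sg_le t : sg * t <= `|t|.
  by rewrite (le_trans (ler_norm _))// normrM sg1 mul1r.
have sg_abs t : 0 <= sg * t -> `|t| = sg * t.
  by move=> /ger0_norm <-; rewrite normrM sg1 mul1r.
apply: le_trans (Re_le_cabs _); apply: le_trans (sg_le _).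
rewrite Re_sum mulr_sumr.
have -> : cabs (a (N1 + k1)%N%:Z) = sg * Re (a (N1 + k1)%N%:Z).
  by rewrite -{1}(RRe_real (a_re k1)) cabs_real sg_abs.
apply: (@le_trans _ _ (sg * Re ((tau k1)%:C * coef y (N1 + k1)%N%:Z))).
  by rewrite termE.
rewrite (bigD1 (Ordinal k1D))//; apply: ler_wpDr => //.
by apply: sumr_ge0 => k _; exact: term0.
Qed.

(** Upper bound by [form_times_dirichlet], lower bound by
    [window_lower_bound].  The window of frequencies starts at N1 = n - k1, so
    that n receives the largest weight; it has length m L <= n / 2, so that
    every frequency is at least n / 2 and, for y = 2 B / n, every Bessel
    argument is at least B. *)
Lemma coef_window_bound (sg B C : R) (N0 P m n L : nat) (y : R) :
  `|sg| = 1 ->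
  (forall n : nat, (1 <= n)%N -> a n%:Z \is Num.real) ->
  (forall n : nat, (N0 <= n)%N -> 0 <= sg * Re (a n%:Z)) ->
  0 < B -> (forall u, B <= u -> 0 < Re (K u)) -> 0 < C ->
  (forall x y (L : nat), 0 < y ->
    cabs (g (x +i* y)) * cabs (\sum_(j < L) circ (- x) ^+ j) ^+ m * y ^+ P
    <= C * (4 / cos 1 ^+ 2 + (y * L%:R) ^+ 2) ^+ P) ->
  (0 < m)%N -> (0 < L)%N -> (2 * (m * L) <= n)%N -> (2 * N0 <= n)%N ->
  y = 2 * B / n%:R -> y <= 1 ->
  cabs (a n%:Z) * (Re (K (4 * pi * B)) * y * L%:R ^+ m.-1) <=
  m%:R * (C * (4 / cos 1 ^+ 2 + B ^+ 2) ^+ P / y ^+ P).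
Proof.
move=> sg1 a_real a_sign B0 Kpos C0 hC m0 L0 Ln nN0 yE y1.
have pi2 := pi_ge2 R.
have [pi21 pi41] : 1 <= 2 * pi :> R /\ 1 <= 4 * pi :> R by split; lra.
have [tau [tau0 tauE [k1 k1D hk1]]] := @dirichlet_power R m L m0 L0.
have [N1 [N1k1 N1n]] : exists N1, (N1 + k1)%N = n /\ (n <= 2 * N1)%N.
  by exists (n - k1)%N; lia.
have n0 : (0 < n)%N.
  by rewrite (leq_trans _ Ln)// muln_gt0 muln_gt0 m0 L0.
have N10 : (0 < N1)%N by clear -n0 N1n; lia.
have N1N0 : (N0 <= N1)%N.
  by rewrite -(leq_pmul2l (ltn0Sn 1)) (leq_trans nN0).
have nR : (0 : R) < n%:R by rewrite ltr0n.
have y0 : 0 < y by rewrite yE divr_gt0// mulr_gt0.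
have yn : y * n%:R = 2 * B by rewrite yE divfK// gt_eqF.
have yP0 : 0 < y ^+ P by rewrite exprn_gt0.
have rE : Re (K (2 * pi * n%:R * y)) = Re (K (4 * pi * B)).
  by congr (Re (K _)); rewrite -mulrA [_ * y]mulrC yn; ring.
have ext : cabs (\sum_(k < m * L) (tau k)%:C * coef y (N1 + k)%N%:Z)
    <= C * (4 / cos 1 ^+ 2 + B ^+ 2) ^+ P / y ^+ P.
  apply: (@fourier_extract _ _ (fun x => g (x +i* y)) (m * L) tau
    (fun k => (N1 + k)%N%:Z)) => //.
  - exact: fourier_series_uniform (maass_fourier_series g_four y0).
  - by move=> k _ /=; rewrite addn_gt0 N10.
  move=> x; rewrite sum_dirichlet_shift tauE cabsM [cabs (circ _ * _)]cabsM.
  rewrite cabs_circ mul1r cabsX ler_pdivlMr//; apply: le_trans (hC x y L y0) _.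
  rewrite ler_pM2l// lerXn2r ?nnegrE ?addr_ge0 ?sqr_ge0 ?divr_ge0 ?sqr_ge0//.
  rewrite lerD2l lerXn2r ?nnegrE ?mulr_ge0 ?(ltW y0) ?(ltW B0)//.
  have Ln2 : 2 * L%:R <= n%:R :> R.
    by rewrite -natrM ler_nat (leq_trans _ Ln)// leq_pmul2l// leq_pmull.
  by have := ler_wpM2l (ltW y0) Ln2; rewrite yn mulrCA ler_pM2l.
have BN1 : B <= 2 * pi * N1%:R * y.
  have h1 : n%:R <= 2 * N1%:R :> R by rewrite -natrM ler_nat.
  have h2 : B <= N1%:R * y.
    by have := ler_wpM2l (ltW y0) h1; rewrite yn mulrCA ler_pM2l// mulrC.
  apply: le_trans h2 _; rewrite -mulrA ler_peMl//.
  by rewrite mulr_ge0 ?ler0n ?(ltW y0).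
have low := window_lower_bound sg1 a_real a_sign Kpos tau0 y0 N1N0 N10 k1D BN1.
rewrite N1k1 rE in low; have {}low := le_trans low ext.
have r0 : 0 < Re (K (4 * pi * B)) by apply: Kpos; rewrite ler_peMl ?(ltW B0).
have LR : (0 : R) < L%:R by rewrite ltr0n.
have tauL : L%:R ^+ m.-1 <= m%:R * tau k1.
  rewrite -(ler_pM2r LR) -exprSr prednK// (le_trans hk1)//.
  by rewrite natrM mulrAC.
have ys : y <= Num.sqrt y.
  rewrite -{1}(sqr_sqrtr (ltW y0)) expr2 ler_piMr ?sqrtr_ge0//.
  by rewrite -sqrtr1 ler_sqrt.
apply: le_trans (ler_wpM2l (ler0n R m) low).
move: (Re _) r0 => r r0.
rewrite (_ : m%:R * (tau k1 * _) =
    cabs (a n%:Z) * (r * Num.sqrt y * (m%:R * tau k1))); last by ring.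
rewrite ler_wpM2l ?cabs_ge0//; apply: ler_pM => //.
- by rewrite mulr_ge0 ?ltW.
by rewrite ler_pM2l.
Qed.

(** [coef_window_bound] with P = p + 2, m = 2 P and L about n / (2 m): the
    weight is of size n^(m - 1), the factor y costs one power of n and the upper
    bound n^P, which leaves n^(P - 2) = n^p. *)
Lemma coef_rapid_decay (sg : R) (N0 : nat) (p : nat) : `|sg| = 1 ->
  (forall n : nat, (1 <= n)%N -> a n%:Z \is Num.real) ->
  (forall n : nat, (N0 <= n)%N -> 0 <= sg * Re (a n%:Z)) ->
  exists2 C : R, 0 < C & forall n : nat, cabs (a n%:Z) * n%:R ^+ p <= C.
Proof.
move=> sg1 a_real a_sign.
have [c [kappa [B [c0 k0 B0 hK]]]] := besselK_lower ('i%C * nu).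
have pi2 := pi_ge2 R.
have Kpos u : B <= u -> 0 < Re (K u).
  by move=> /hK; apply: lt_le_trans; rewrite mulr_gt0 ?expR_gt0.
have [P [m [mE mp]]] : exists P m, (2 * P = m.+1)%N /\ m = (p + P).+1.
  by exists p.+2, (2 * p.+2).-1; split; lia.
have [C C0 hC] := form_times_dirichlet g_inv g_four P; rewrite mE in hC.
have pi41 : 1 <= 4 * pi :> R by lra.
have r0 : 0 < Re (K (4 * pi * B)) by apply: Kpos; rewrite ler_peMl ?(ltW B0).
have window := coef_window_bound (N0 := N0) (P := P) (m := m.+1)
  sg1 a_real a_sign B0 Kpos C0 hC.
move: (Re _) r0 window => r r0 window.
set A := C * _ ^+ P in window.
pose q : R := 4 * m.+1%:R.
have q0 : 0 < q by rewrite mulr_gt0.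
pose N := (2 * (N0 + m.+1) + (Num.truncn (2 * B)).+1)%N.
apply: (@eventually_bounded R _ N
  (m.+1%:R * A / (2 * B) ^+ P / (r * (2 * B) / q ^+ m))) => n nN.
have nm : (2 * m.+1 <= n)%N by rewrite (leq_trans _ nN)// /N; lia.
have nN0 : (2 * N0 <= n)%N by rewrite (leq_trans _ nN)// /N; lia.
have n0 : (0 : R) < n%:R by rewrite ltr0n (leq_trans _ nm).
pose L := (n %/ (2 * m.+1))%N.
have L0 : (0 < L)%N by rewrite divn_gt0.
have Ln : (2 * (m.+1 * L) <= n)%N by rewrite mulnA mulnC leq_trunc_div.
have nL : (n <= 4 * m.+1 * L)%N.
  have := ltn_ceil n (_ : 0 < 2 * m.+1)%N => /(_ isT); rewrite -/L; nia.
have nLR : n%:R / q <= L%:R.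
  by rewrite ler_pdivrMr// mulrC /q -!natrM ler_nat.
have y1 : 2 * B / n%:R <= 1.
  rewrite ler_pdivrMr// mul1r ltW// (lt_le_trans (truncnS_gt _))// ler_nat.
  by rewrite (leq_trans _ nN)// leq_addl.
have key := window n L _ isT L0 Ln nN0 (erefl _) y1.
have {}key : cabs (a n%:Z) * (r * (2 * B / n%:R) * (n%:R / q) ^+ m) <=
    m.+1%:R * (A / (2 * B / n%:R) ^+ P).
  apply: le_trans key; rewrite ler_wpM2l ?cabs_ge0//.
  rewrite ler_wpM2l ?mulr_ge0 ?divr_ge0 ?mulr_ge0 ?(ltW r0) ?(ltW B0)//.
  by rewrite lerXn2r ?nnegrE ?divr_ge0 ?(ltW q0).
rewrite ler_pdivlMr; last by rewrite divr_gt0 ?mulr_gt0// exprn_gt0.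
rewrite -(ler_pM2r (exprn_gt0 P n0)); move: key.
have -> : m.+1%:R * (A / (2 * B / n%:R) ^+ P) =
    m.+1%:R * A / (2 * B) ^+ P * n%:R ^+ P.
  by rewrite expr_div_n invf_div; ring.
suff -> : r * (2 * B / n%:R) * (n%:R / q) ^+ m =
  n%:R ^+ p * (r * (2 * B) / q ^+ m) * n%:R ^+ P.
  by rewrite !mulrA.
rewrite expr_div_n {1}mp exprS exprD; field.
by rewrite expf_neq0 ?gt_eqF.
Qed.

End EventualSign.

(** * Vanishing of the form *)

Section Vanishing.
Context {R : realType} (nu : R[i]) (g : R[i] -> R[i]) (a : int -> R[i]).
Context (g_inv : modular_invariant g) (g_four : maass_fourier_expansion nu a g).
Context (a_decay : forall p : nat, exists2 C : R, 0 < C &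
  forall n : nat, (0 < n)%N -> pair_abs a n * n%:R ^+ p <= C).
Implicit Types x y u : R.

Local Notation K := (besselK ('i%C * nu)).
Local Notation coef := (maass_coef nu a).

(** The exponent k of the Bessel bound is fixed once and for all, whereas q is
    arbitrary by the decay of the coefficients. *)
Lemma coef_tail : exists k : nat, forall q : nat, exists2 C : R, 0 < C &
  forall y (X : nat), 0 < y -> y <= 1 -> (0 < X)%N ->
    tail_le (coef y) X (C / (y ^+ k * X%:R ^+ q)).
Proof.
have [C2 [k [C20 hK]]] := besselK_bound ('i%C * nu).
have pi2 := pi_ge2 R.
exists k => q; have [C1 C10 hC1] := a_decay q.+2.
exists (C1 * C2) => [|y X y0 y1 X0 Y]; first exact: mulr_gt0.
have yk0 : 0 < y ^+ k by rewrite exprn_gt0.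
have XR : (0 : R) < X%:R by rewrite ltr0n.
have Xq0 : (0 : R) < X%:R ^+ q by rewrite exprn_gt0.
have sy1 : Num.sqrt y <= 1 by rewrite -sqrtr1 ler_sqrt.
have termle (n : nat) : (X < n)%N ->
    pair_abs (coef y) n <= C1 * C2 / (y ^+ k * X%:R ^+ q) * n%:R ^- 2.
  move=> Xn; have n0 : (0 < n)%N by rewrite (leq_trans _ Xn).
  have nR : (0 : R) < n%:R by rewrite ltr0n.
  have n1 : (1 : R) <= n%:R by rewrite ler1n.
  have pin : 1 <= 2 * pi * n%:R :> R by nra.
  have u0 : 0 < 2 * pi * n%:R * y by rewrite mulr_gt0// (lt_le_trans ltr01).
  have Kle : cabs (K (2 * pi * n%:R * y)) <= C2 / y ^+ k.
    apply: le_trans (hK _ u0) _; rewrite -mulrA ler_pM2l//.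
    rewrite -[leRHS]mulr1 ler_pM ?invr_ge0 ?exprn_ge0 ?expR_ge0 ?(ltW u0)//.
      rewrite lef_pV2 ?posrE ?exprn_gt0// lerXn2r ?nnegrE ?(ltW y0) ?(ltW u0)//.
      by rewrite ler_peMl// ltW.
    by rewrite -[leRHS]expR0 ler_expR oppr_le0 divr_ge0// ltW.
  rewrite pair_abs_maass_coef.
  have ale : pair_abs a n <= C1 / (X%:R ^+ q * n%:R ^+ 2).
    rewrite ler_pdivlMr ?mulr_gt0 ?exprn_gt0//; apply: le_trans (hC1 n n0).
    rewrite ler_wpM2l ?pair_abs_ge0// -[q.+2]addn2 exprD ler_wpM2r ?sqr_ge0//.
    by rewrite lerXn2r ?nnegrE// ler_nat ltnW.
  apply: (@le_trans _ _ (C1 / (X%:R ^+ q * n%:R ^+ 2) * 1 * (C2 / y ^+ k))).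
    rewrite ler_pM ?mulr_ge0 ?pair_abs_ge0 ?sqrtr_ge0 ?cabs_ge0//.
    by rewrite ler_pM ?pair_abs_ge0 ?sqrtr_ge0.
  by rewrite le_eqVlt; apply/orP; left; apply/eqP; field; rewrite !gt_eqF.
apply: (@le_trans _ _ (\sum_(X.+1 <= n < Y)
   C1 * C2 / (y ^+ k * X%:R ^+ q) * n%:R ^- 2)).
  by apply: ler_sum_nat => n /andP[Xn _]; exact: termle.
rewrite -mulr_sumr -[leRHS]mulr1 ler_wpM2l//.
  by rewrite divr_ge0 ?mulr_ge0 ?(ltW C10) ?(ltW C20)// ltW.
by rewrite (le_trans (sum_inv_sqr_tail _ X0))// invf_le1// ler1n.
Qed.

Lemma fourier_series_le (c : int -> R[i]) (f : R -> R[i]) X (d d' : R) x :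
  fourier_series c f -> \sum_(1 <= n < X.+1) pair_abs c n <= d ->
  tail_le c X d' -> cabs (f x) <= d + d'.
Proof.
move=> hf hd hd'; apply: nonzero_int_sum_le (hf x) _ _; last first.
  by apply/tail_le_fourier; exact: hd'.
by rewrite (eq_bigr (pair_abs c))// => n _; exact: pair_abs_fourier.
Qed.

(** The coefficients of rank at most X are averages over the nodes, and the
    others contribute at most d. *)
Lemma form_le_nodes y (X : nat) (M d : R) x : 0 < y ->
  tail_le (coef y) X d ->
  (forall j, (j < (2 * X).+1)%N ->
    cabs (g ((j%:R / (2 * X).+1%:R) +i* y)) <= M) ->
  cabs (g (x +i* y)) <= X%:R * (2 * (M + d)) + d.
Proof.
move=> y0 hd hM.
have hf := maass_fourier_series g_four y0.
apply: (fourier_series_le x hf _ hd).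
have one (k : int) : (0 < `|k| <= X)%N -> cabs (coef y k) <= M + d.
  move=> kX; have := @fourier_extract_nodes _ (coef y) _ 1 X (2 * X).+1
    (fun=> 1) (fun=> k) M d (fourier_series_approx hf hd) (fun _ _ => kX)
    (leqnn _) (fun=> ler01).
  rewrite !big_ord1 mulr1 mul1r; apply => j jX.
  by rewrite big_ord1 mul1r cabsM cabs_circ mulr1 hM.
have -> : X%:R * (2 * (M + d)) = \sum_(1 <= n < X.+1) 2 * (M + d) :> R.
  by rewrite sumr_const_nat subn1 mulr_natl.
apply: ler_sum_nat => n /andP[n0 nX]; rewrite mulrDl mul1r.
by rewrite lerD// one ?abszN/= ?n0.
Qed.

(** The point -1 / (z + X^2), whose height is of exact order X^(-4). *)
Lemma low_orbit_point (x0 y0 : R) (X : nat) : 0 < y0 -> (0 < X)%N ->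
  2 * `|x0| <= X%:R -> 4 * y0 <= X%:R ->
  exists x y, [/\ 0 < y, y <= 1, g (x +i* y) = g (x0 +i* y0),
    y0 / ((`|x0| + 1) ^+ 2 + y0 ^+ 2) / X%:R ^+ 4 <= y &
    y <= 4 * y0 / X%:R ^+ 4].
Proof.
move=> y00 X0 hx hy.
have X1 : (1 : R) <= X%:R by rewrite ler1n.
pose r : R := X%:R ^+ 2; have r1 : 1 <= r by rewrite exprn_ege1.
have Xr : X%:R <= r by rewrite /r expr2 ler_peMl// (le_trans ler01).
have r4 : X%:R ^+ 4 = r ^+ 2 by rewrite -exprM.
pose x1 := x0 + r; pose n := x1 ^+ 2 + y0 ^+ 2.
have n0 : 0 < n by rewrite ltr_wpDl ?sqr_ge0// exprn_gt0.
have ab := ler_norm x0; have abN : - x0 <= `|x0| by rewrite -normrN ler_norm.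
have a0 := normr_ge0 x0.
have E0 : 0 < (`|x0| + 1) ^+ 2 + y0 ^+ 2.
  by rewrite ltr_wpDl ?sqr_ge0// exprn_gt0.
have r0 : 0 < r by rewrite (lt_le_trans ltr01).
have r20 : 0 < r ^+ 2 by rewrite exprn_gt0.
have up : y0 / n <= 4 * y0 / r ^+ 2.
  have h : r / 2 <= x1 by rewrite /x1; lra.
  have h2 : (r / 2) ^+ 2 <= x1 ^+ 2.
    by rewrite lerXn2r ?nnegrE ?(le_trans _ h)// divr_ge0// ltW.
  have h3 : r ^+ 2 <= 4 * n.
    by have := sqr_ge0 y0; move: h2; rewrite /n expr_div_n; lra.
  rewrite ler_pdivlMr// mulrAC ler_pdivrMr// [4 * y0]mulrC -mulrA.
  by rewrite ler_pM2l.
exists (- x1 / n), (y0 / n); split.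
- by rewrite divr_gt0.
- apply: le_trans up _; rewrite ler_pdivrMr// mul1r (le_trans hy)//.
  by rewrite (le_trans Xr)// expr2 ler_peMl// ltW.
- rewrite /n modular_inversion// -(modular_translate x0 (X ^ 2)%N%:Z g_inv y00).
  by rewrite -pmulrn natrX.
- rewrite r4 -mulrA ler_pM2l// -invfM lef_pV2 ?posrE ?(mulr_gt0 E0)//.
  rewrite mulrDl lerD//; last by rewrite ler_peMr ?sqr_ge0// exprn_ege1.
  rewrite -exprMn -(real_normK (num_real x1)) lerXn2r ?nnegrE//.
    by rewrite mulr_ge0 ?addr_ge0// ltW.
  rewrite (le_trans (ler_normD _ _))// [`|r|]ger0_norm ?(ltW r0)//.
  by rewrite mulrDl mul1r lerD2r ler_peMr.
by rewrite r4.
Qed.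

(** At a point of the orbit of height y ~ X^(-4), the values at the nodes are
    O(q^2 y) = O(X^(-2)) with q = 2 X + 1, and the tail is O(X^(-2)) as well.
    With 2 X coefficients to add, g z = O(1 / X) for every X. *)
Lemma form_vanishes z : upper z -> g z = 0.
Proof.
case: z => x0 y0; rewrite /upper /= => y00.
have [k hk] := coef_tail; have [C C0 hC] := hk (4 * k + 2)%N.
have [C1 C10 hC1] := form_decay g_inv g_four 1.
pose E := (`|x0| + 1) ^+ 2 + y0 ^+ 2.
have E0 : 0 < E by rewrite ltr_wpDl ?sqr_ge0// exprn_gt0.
pose c := y0 / E; have c0 : 0 < c by rewrite divr_gt0.
pose N := ((Num.truncn (2 * `|x0|)).+1 + (Num.truncn (4 * y0)).+1)%N.
(* 36 = 9 * 4, from q^2 <= 9 X^2 and y <= 4 y0 / X^4; the last term comes from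
   the tail, by y >= c / X^4 *)
pose B := 3 * (36 * C1 * y0 + C / c ^+ k).
have main (X : nat) : (N <= X)%N -> cabs (g (x0 +i* y0)) <= B / X%:R.
  move=> NX.
  have X0 : (0 < X)%N by rewrite (leq_trans _ NX)// /N addnS.
  have XR : (0 : R) < X%:R by rewrite ltr0n.
  have XN (t : R) : (Num.truncn t < N)%N -> t <= X%:R.
    move=> tN; rewrite ltW// (lt_le_trans (truncnS_gt _))// ler_nat.
    exact: leq_trans tN NX.
  have hx : 2 * `|x0| <= X%:R by apply: XN; rewrite /N addSn ltnS leq_addr.
  have hy : 4 * y0 <= X%:R by apply: XN; rewrite /N addnS ltnS leq_addl.
  have [x [y [yp y1 <- ylow yup]]] := low_orbit_point y00 X0 hx hy.
  pose M := 36 * C1 * y0 / X%:R ^+ 2; pose d := C / c ^+ k / X%:R ^+ 2.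
  have X20 : (0 : R) < X%:R ^+ 2 by rewrite exprn_gt0.
  have ck0 : 0 < c ^+ k by rewrite exprn_gt0.
  have tail : tail_le (coef y) X d.
    move=> Y; apply: le_trans (hC y X yp y1 X0 Y) _.
    rewrite /d -!mulrA ler_pM2l// -invfM lef_pV2 ?posrE ?mulr_gt0 ?exprn_gt0//.
    rewrite exprD exprM mulrA ler_pM2r// -exprMn lerXn2r ?nnegrE//.
    - by rewrite ltW.
    - by rewrite mulr_ge0 ?exprn_ge0// ltW.
    by rewrite -ler_pdivrMr ?exprn_gt0.
  have nodes j : (j < (2 * X).+1)%N ->
      cabs (g ((j%:R / (2 * X).+1%:R) +i* y)) <= M.
    have [x' [y' [y'0 -> hy']]] := modular_cusp j g_inv yp (ltn0Sn (2 * X)).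
    move=> _.
    have q0 : (0 : R) < (2 * X).+1%:R ^+ 2 by rewrite exprn_gt0.
    have q9 : (2 * X).+1%:R ^+ 2 <= 9 * X%:R ^+ 2 :> R.
      have -> : 9 * X%:R ^+ 2 = (3 * X)%N%:R ^+ 2 :> R by rewrite natrM; ring.
      by rewrite lerXn2r ?nnegrE// ler_nat (mulnDl 2 1) mul1n -addn1 leq_add2l.
    have := hC1 x' y' y'0; rewrite expr1 => h.
    apply: (@le_trans _ _ (C1 * ((2 * X).+1%:R ^+ 2 * y))).
      apply: le_trans (ler_wpM2r _ h); last by rewrite mulr_ge0// ltW.
      by rewrite -mulrA ler_peMr ?cabs_ge0.
    have -> : M = C1 * (36 * y0 / X%:R ^+ 2) by rewrite /M; ring.
    rewrite ler_pM2l//.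
    apply: le_trans (ler_pM _ _ q9 yup) _; rewrite ?(ltW q0) ?(ltW yp)//.
    by rewrite le_eqVlt; apply/orP; left; apply/eqP; field; rewrite gt_eqF.
  apply: le_trans (form_le_nodes x yp tail nodes) _.
  have Md : M + d = B / 3 / X%:R ^+ 2.
    by rewrite /M /d /B; field; rewrite !gt_eqF.
  have B0 : 0 <= B.
    by rewrite mulr_ge0// addr_ge0 ?divr_ge0 ?mulr_ge0 ?exprn_ge0// ltW.
  have dle : d <= B / 3 / X%:R.
    apply: (@le_trans _ _ (B / 3 / X%:R ^+ 2)).
      by rewrite -Md lerDr /M divr_ge0 ?mulr_ge0// ltW.
    rewrite ler_wpM2l ?divr_ge0// lef_pV2 ?posrE//.
    by rewrite expr2 ler_peMl ?(ltW XR)// ler1n.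
  apply: le_trans (lerD (lexx _) dle) _; rewrite Md.
  by rewrite le_eqVlt; apply/orP; left; apply/eqP; field; rewrite gt_eqF.
apply: Normc.eq0_normc; apply/eqP; rewrite eq_le cabs_ge0 andbT.
apply/ler_addgt0Pr => e e0; rewrite add0r.
have B0 : 0 < B.
  by rewrite mulr_gt0// addr_gt0 ?divr_gt0 ?mulr_gt0 ?exprn_gt0.
pose X := (N + (Num.truncn (B / e)).+1)%N.
have X0 : (0 : R) < X%:R by rewrite ltr0n /X addnS.
apply: le_trans (main X (leq_addr _ _)) _.
rewrite ler_pdivrMr// mulrC -ler_pdivrMr// ltW//.
by rewrite (lt_le_trans (truncnS_gt _))// ler_nat leq_addl.
Qed.

End Vanishing.

Lemma finite_eventually (P : nat -> bool) :
  ~ infinite_set [set n | P n]%classic ->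
  exists N, forall n, (N <= n)%N -> ~~ P n.
Proof.
move=> /contrapT /finite_seqP [s sE].
exists (\max_(i <- s) i).+1 => n Nn; apply/negP => Pn.
have : n \in s by have : [set n | P n]%classic n by []; rewrite sE.
by move=> ns; move: Nn; rewrite ltnNge leq_bigmax_seq.
Qed.

(** The parity of the form transfers the decay of the a_n with n > 0 to those
    with n < 0. *)
Lemma eventual_sign_vanishes (R : realType) (nu : R[i]) (g : R[i] -> R[i])
    (a : int -> R[i]) (eps : R[i]) (sg : R) (N0 : nat) :
  modular_invariant g -> maass_fourier_expansion nu a g ->
  cabs eps = 1 ->
  (forall x y, 0 < y -> g ((- x) +i* y) = eps * g (x +i* y)) ->
  (forall n : nat, (1 <= n)%N -> a n%:Z \is Num.real) ->
  `|sg| = 1 -> (forall n : nat, (N0 <= n)%N -> 0 <= sg * Re (a n%:Z)) ->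
  forall z, upper z -> g z = 0.
Proof.
move=> g_inv g_four eps1 hpar a_real sg1 a_sign.
apply: (form_vanishes g_inv g_four) => p.
have [C C0 hC] := coef_rapid_decay g_inv g_four p sg1 a_real a_sign.
exists (2 * C) => [|n n0]; first by rewrite mulr_gt0.
rewrite /pair_abs (coef_parity g_four hpar n0) cabsM eps1 mul1r.
by have := hC n; lra.
Qed.

Theorem mainTheorem4 (R : realType) (nu : R[i]) (g : R[i] -> R[i])
    (a : int -> R[i])
    (g_cusp : maass_cusp_form (1 / 4 + nu ^+ 2) g)
    (g_neq0 : nonzero_form g)
    (g_fourier : maass_fourier_expansion nu a g)
    (g_parity : even_form g \/ odd_form g)
    (a_real : forall n : nat, (1 <= n)%N -> a n%:Z \is Num.real) :
  changes_signs_infinitely_often (fun k : nat => complex.Re (a (k.+1)%:Z)).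
Proof.
have g_inv : modular_invariant g by exact: maass_invariant g_cusp.
have [eps eps1 hpar] : exists2 eps : R[i], cabs eps = 1 &
    forall x y, 0 < y -> g ((- x) +i* y) = eps * g (x +i* y).
  have reflectE (x y : R) : (- x) +i* y = - (x +i* y)^*.
    by apply: (congr1 (Complex (- x))); rewrite opprK.
  case: g_parity => h; [exists 1|exists (-1)];
    rewrite ?cabsN ?cabs1// => x y y0.
    by rewrite reflectE h// mul1r.
  by rewrite reflectE h// mulN1r.
have no_sign (sg : R) (N0 : nat) : `|sg| = 1 ->
    ~ (forall k : nat, (N0 <= k)%N -> 0 <= sg * Re (a k.+1%:Z)).
  move=> sg1 hs; case: g_neq0 => z zup /eqP; apply.
  apply: (eventual_sign_vanishes (N0 := N0.+1) g_inv g_fourier eps1 hpar a_real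
    sg1 _ zup).
  by case=> // n Nn; apply: hs.
split; apply: contrapT => /finite_eventually [N hN].
  apply: (no_sign (-1) N) => [|k Nk]; first by rewrite normrN1.
  by rewrite mulN1r oppr_ge0 leNgt hN.
apply: (no_sign 1 N) => [|k Nk]; first by rewrite normr1.
by rewrite mul1r leNgt hN.
Qed.
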